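(* Let $q\in\mathbb{C}\setminus\{0\}$, $N\ge 1$ and $\rho\in\{1,-1\}$. Then $V(N,\rho)$ is a module for the Lie algebra $\widehat{\mathcal{G}_\rho}$ under the action $\pi$ given (linearly) by $$\pi(\tilde g_{ij}(m,n))=G_{ij}(m,n),\quad \pi(\tilde f_{ij}(m,n))=F_{ij}(m,n),\quad \pi(\tilde h_{ij}(m,n))=H_{ij}(m,n),$$ $$\pi(c(n))=\frac{\rho}{2}\,\mathrm{id}\ \ (n\in\Lambda(q)),\qquad \pi(c_y)=0 ,$$ where in the first line $m,n\in\mathbb{Z}$ and $1\le i,j\le N$, and elements of $\mathcal{G}_\rho$ are written as linear combinations of the $\tilde f_{ij}(m,n),\tilde g_{ij}(m,n),\tilde h_{ij}(m,n)$.
   Context: Quantum torus: $\mathbb{C}_q$ is the unital associative $\mathbb{C}$-algebra with generators $x^{\pm1},y^{\pm1}$ and relations $xx^{-1}=x^{-1}x=yy^{-1}=y^{-1}y=1$, $yx=qxy$; it has basis $\{x^my^n\}_{m,n\in\mathbb{Z}}$. $\Lambda(q)=\{n\in\mathbb{Z}: q^n=1\}$. The bar is the anti-involution ($\mathbb{C}$-linear) of $\mathbb{C}_q$ with $\bar x=x$, $\bar y=y^{-1}$. Lie algebra $\widehat{gl_r(\mathbb{C}_q)}$: as a vector space it is $gl_r(\mathbb{C}_q)\oplus\bigl(\bigoplus_{n\in\Lambda(q)}\mathbb{C}c(n)\bigr)\oplus\mathbb{C}c_y$, with all $c(n)$ and $c_y$ central and, writing $e_{ij}(a)=a e_{ij}$,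 $$[e_{ij}(x^my^n),e_{kl}(x^py^s)]=\delta_{jk}q^{np}e_{il}(x^{m+p}y^{n+s})-\delta_{il}q^{ms}e_{kj}(x^{m+p}y^{n+s})+mq^{np}\delta_{jk}\delta_{il}\delta_{m+p,0}\delta_{\overline{n+s},\overline 0}\,c(n+s)+nq^{np}\delta_{jk}\delta_{il}\delta_{m+p,0}\delta_{n+s,0}\,c_y,$$ where $\bar t$ denotes the class of $t$ in $\mathbb{Z}/\Lambda(q)$ (so the $c(n+s)$ term is present only if $n+s\in\Lambda(q)$). Lie algebra $\mathcal{G}_\rho$: let $G=\begin{pmatrix}0&I_N\\ \rho I_N&0\end{pmatrix}\in M_{2N}(\mathbb{C}_q)$, $A^*=G^{-1}\bar A^tG$ (bar entrywise), $S_\rho=\{A\in M_{2N}(\mathbb{C}_q):A^*=-A\}$, and $\mathcal{G}_\rho=[S_\rho,S_\rho]$ (commutator bracket). Then $S_\rho$ is spanned by the elements ($m,n\in\mathbb{Z}$, $1\le i,j\le N$) $$\tilde f_{ij}(m,n)=x^my^ne_{ij}-\overline{x^my^n}e_{N+j,N+i},\quad \tilde g_{ij}(m,n)=x^my^ne_{i,N+j}-\rho\overline{x^my^n}e_{j,N+i},\quad \tilde h_{ij}(m,n)=\rho x^my^ne_{N+i,j}-\overline{x^my^n}e_{N+j,i}.$$ $\widehat{\mathcal{G}_\rho}=\mathcal{G}_\rho\oplus\bigl(\bigoplus_{n\in\Lambda(q)}\mathbb{C}c(n)\bigr)\oplus\mathbb{C}c_y$ with the bracket restricted from $\widehat{gl_{2N}(\mathbb{C}_q)}$.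 The module: put $\{a,b\}_\rho=ab+\rho ba$. $\alpha(N,\rho)$ is the unital associative algebra generated by $a_i(m),a_i^*(m)$ ($1\le i\le N$, $m\in\mathbb{Z}$) with relations $\{a_i(m),a_j(n)\}_\rho=\{a_i^*(m),a_j^*(n)\}_\rho=0$, $\{a_i(m),a_j^*(n)\}_\rho=\rho\delta_{ij}\delta_{m+n,0}$. $V(N,\rho)$ is a simple $\alpha(N,\rho)$-module containing a (nonzero) vacuum vector $v_0$ killed by all annihilation operators $a_i(n),a_i^*(n)$ ($n>0$) and $a_i^*(0)$, $1\le i\le N$. Normal ordering, for $u,v\in\{a_i,a_i^*\}$: $:u(m)v(n):\,=u(m)v(n)$ if $n>m$; $=\frac12(u(m)v(n)-\rho v(n)u(m))$ if $m=n$; $=-\rho v(n)u(m)$ if $m>n$. Operators on $V(N,\rho)$ (only finitely many summands are nonzero on any given vector): $$f_{ij}(m,n)=\sum_{s\in\mathbb{Z}}q^{-ns}:a_i(m-s)a_j^*(s):,\quad g_{ij}(m,n)=\sum_{s\in\mathbb{Z}}q^{-ns}:a_i(m-s)a_j(s):,\quad h_{ij}(m,n)=\sum_{s\in\mathbb{Z}}q^{-ns}:a_i^*(m-s)a_j^*(s):,$$ $G_{ij}(m,n)=g_{ij}(m,n)$, $H_{ij}(m,n)=h_{ij}(m,n)$, and $F_{ij}(m,n)=f_{ij}(m,n)$ if $n\in\Lambda(q)$, $F_{ij}(m,n)=f_{ij}(m,n)-\frac12\rho\,\delta_{ij}\delta_{m,0}\frac{q^n+1}{q^n-1}$ if $n\in\mathbb{Z}\setminus\Lambda(q)$.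 *)

(* Defs.v *)
From HB Require Import structures.
From mathcomp Require Import all_boot all_order all_algebra.
From mathcomp Require Import finmap ring zify.
From mathcomp Require Import boolp classical_sets functions fsbigop.
From mathcomp Require Import monalg.

Set Implicit Arguments.
Unset Strict Implicit.
Unset Printing Implicit Defensive.

Import Order.TTheory GRing.Theory Num.Theory.

Local Open Scope ring_scope.

(* [mlin f] is the linear map sending the basis vector << k >> to [f k]. *)
HB.lock Definition mlin (F : fieldType) (K : choiceType) (W : lmodType F)
    (f : K -> W) (a : {malg F[K]}) : W :=
  \sum_(k <- msupp a) a@_k *: f k.

Section LinearExtension.
Variables (F : fieldType) (K : choiceType).

Lemma mlinE (W : lmodType F) (f : K -> W) a :
  mlin f a = \sum_(k <- msupp a) a@_k *: f k.
Proof. by rewrite mlin.unlock. Qed.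

Lemma mlinEw (W : lmodType F) (f : K -> W) (d : {fset K}) a :
  (msupp a `<=` d)%fset -> mlin f a = \sum_(k <- d) a@_k *: f k.
Proof.
move=> le_d; apply/esym; rewrite mlinE (big_fset_incl _ le_d) //.
by move=> k _ /mcoeff_outdom ->; rewrite scale0r.
Qed.

Lemma mlin_is_linear (W : lmodType F) (f : K -> W) : linear (mlin f).
Proof.
move=> c a b.
pose d := (msupp a `|` msupp b `|` msupp (c *: a + b))%fset.
have da : (msupp a `<=` d)%fset by rewrite /d -fsetUA fsubsetUl.
have db : (msupp b `<=` d)%fset by rewrite /d fsetUAC fsubsetUr.
have dc : (msupp (c *: a + b) `<=` d)%fset by rewrite /d fsubsetUr.
rewrite (mlinEw f da) (mlinEw f db) (mlinEw f dc).
rewrite scaler_sumr -big_split /=; apply: eq_bigr => k _.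
by rewrite mcoeffD mcoeffZ scalerDl scalerA.
Qed.

HB.instance Definition _ (W : lmodType F) (f : K -> W) :=
  GRing.isLinear.Build F {malg F[K]} W _ (mlin f) (mlin_is_linear f).

Lemma mlinU (W : lmodType F) (f : K -> W) k : mlin f << k >> = f k.
Proof. by rewrite mlinE msuppU oner_eq0 big_seq_fset1 mcoeffUU scale1r. Qed.

Lemma eq_mlin (W : lmodType F) (f g : K -> W) : f =1 g -> mlin f =1 mlin g.
Proof. by move=> fg a; rewrite !mlinE; apply: eq_bigr => k _; rewrite fg. Qed.

Lemma mlin_fun (W : lmodType F) c (f g : K -> W) a :
  mlin (fun k => c *: f k + g k) a = c *: mlin f a + mlin g a.
Proof.
rewrite !mlinE scaler_sumr -big_split /=; apply: eq_bigr => k _.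
by rewrite scalerDr !scalerA mulrC.
Qed.

Lemma linear_malgE (W : lmodType F) (f : {malg F[K]} -> W) : linear f ->
  forall a, f a = mlin (fun k => f << k >>) a.
Proof.
move=> lf a.
pose g : {linear {malg F[K]} -> W} := HB.pack f (GRing.isLinear.Build _ _ _ _ f lf).
change (g a = mlin (fun k => g << k >>) a).
rewrite mlinE {1}[a]monalgE raddf_sum; apply: eq_bigr => k _.
rewrite -linearZ; congr (g _); apply/malgP => j.
by rewrite mcoeffZ !mcoeffU mulr_natr.
Qed.

End LinearExtension.

(* The quantum torus, realised on its basis: << (m, n) >> is x^m y^n, and     *)
(* y x = q x y gives (x^m y^n) (x^p y^s) = q^(n p) x^(m+p) y^(n+s). The vector *)
(* space operations are those of {malg F[_]}, locked because unification would *)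
(* otherwise unfold them at each failure.                                     *)
Definition qtorus (F : fieldType) (q : F) (q_neq0 : q != 0) : Type :=
  {malg F[(int * int)%type]}.

Section QuantumTorusModule.
Variables (F : fieldType) (q : F) (q_neq0 : q != 0).
Local Notation Cq := (qtorus q_neq0).
Local Notation M := {malg F[(int * int)%type]}.

HB.instance Definition _ := Choice.copy Cq M.

Fact qtorus_key : unit.
Proof. by []. Qed.

Definition qtzero : Cq := locked_with qtorus_key (0 : M).
Definition qtopp : Cq -> Cq := locked_with qtorus_key (fun a : M => - a).
Definition qtadd : Cq -> Cq -> Cq :=
  locked_with qtorus_key (fun a b : M => a + b).
Definition qtscale : F -> Cq -> Cq :=
  locked_with qtorus_key (fun k (a : M) => k *: a).

Fact qtaddA : associative qtadd.
Proof. by rewrite /qtadd unlock => a b c; apply: (@addrA M). Qed.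
Fact qtaddC : commutative qtadd.
Proof. by rewrite /qtadd unlock => a b; apply: (@addrC M). Qed.
Fact qtadd0 : left_id qtzero qtadd.
Proof. by rewrite /qtadd /qtzero !unlock => a; apply: (@add0r M). Qed.
Fact qtaddN : left_inverse qtzero qtopp qtadd.
Proof. by rewrite /qtadd /qtzero /qtopp !unlock => a; apply: (@addNr M). Qed.

HB.instance Definition _ :=
  GRing.isZmodule.Build Cq qtaddA qtaddC qtadd0 qtaddN.

Fact qtscaleA k l a : qtscale k (qtscale l a) = qtscale (k * l) a.
Proof. by rewrite /qtscale unlock; apply: (@scalerA F M). Qed.
Fact qtscale1 : left_id 1 qtscale.
Proof. by rewrite /qtscale unlock => a; apply: (@scale1r F M). Qed.
Fact qtscaleDr : right_distributive qtscale +%R.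
Proof.
move=> k a b; change (qtscale k (qtadd a b) = qtadd (qtscale k a) (qtscale k b)).
by rewrite /qtscale /qtadd !unlock; apply: (@scalerDr F M).
Qed.
Fact qtscaleDl a : {morph qtscale^~ a : k l / k + l}.
Proof.
move=> k l; change (qtscale (k + l) a = qtadd (qtscale k a) (qtscale l a)).
by rewrite /qtscale /qtadd !unlock; apply: (@scalerDl F M).
Qed.

HB.instance Definition _ :=
  GRing.Zmodule_isLmodule.Build F Cq qtscaleA qtscale1 qtscaleDr qtscaleDl.

Lemma qtorusDE (a b : Cq) : a + b = (a : M) + (b : M).
Proof. by change (qtadd a b = (a : M) + (b : M)); rewrite /qtadd unlock. Qed.

Lemma qtorusZE k (a : Cq) : k *: a = k *: (a : M).
Proof. by change (qtscale k a = k *: (a : M)); rewrite /qtscale unlock. Qed.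

Definition qlin (W : lmodType F) (f : int * int -> W) (a : Cq) : W := mlin f a.

Lemma qlin_is_linear (W : lmodType F) (f : int * int -> W) : linear (qlin f).
Proof. by move=> k a b; rewrite /qlin qtorusDE qtorusZE; apply: mlin_is_linear. Qed.

HB.instance Definition _ (W : lmodType F) (f : int * int -> W) :=
  GRing.isLinear.Build F Cq W _ (qlin f) (qlin_is_linear f).

End QuantumTorusModule.

HB.lock Definition qmon (F : fieldType) (q : F) (q_neq0 : q != 0) (m n : int) :
  qtorus q_neq0 := << (m, n) >>.

HB.lock Definition qtmul (F : fieldType) (q : F) (q_neq0 : q != 0)
    (a b : qtorus q_neq0) : qtorus q_neq0 :=
  qlin (fun u => qlin (fun v =>
    q ^ (u.2 * v.1) *: qmon q_neq0 (u.1 + v.1) (u.2 + v.2)) b) a.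

Section QuantumTorus.
Variables (F : fieldType) (q : F) (q_neq0 : q != 0).
Local Notation Cq := (qtorus q_neq0).

Local Notation qmon := (qmon q_neq0).
Local Notation qtmul := (@qtmul F q q_neq0).

Lemma qmonE m n : qmon m n = << (m, n) >>.
Proof. by rewrite qmon.unlock. Qed.

Lemma qtmulE (a b : Cq) : qtmul a b = qlin (fun u => qlin (fun v =>
  q ^ (u.2 * v.1) *: qmon (u.1 + v.1) (u.2 + v.2)) b) a.
Proof. by rewrite qtmul.unlock. Qed.

Lemma qlin_qmon (W : lmodType F) (f : int * int -> W) m n :
  qlin f (qmon m n) = f (m, n).
Proof. by rewrite qmonE; apply: mlinU. Qed.

Lemma qtmul_linearl b : linear (qtmul^~ b).
Proof. by move=> c a a'; rewrite !qtmulE; apply: qlin_is_linear. Qed.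

Lemma qtmul_linearr a : linear (qtmul a).
Proof.
move=> c b b'; rewrite !qtmulE; apply: etrans (mlin_fun c _ _ a); apply: eq_mlin => u.
exact: qlin_is_linear.
Qed.

Lemma qtmulMM m n p s :
  qtmul (qmon m n) (qmon p s) = q ^ (n * p) *: qmon (m + p) (n + s).
Proof. by rewrite qtmulE !qlin_qmon. Qed.

Lemma eq_linear_qtorus (W : lmodType F) (f g : Cq -> W) :
  linear f -> linear g -> (forall m n, f (qmon m n) = g (qmon m n)) -> f =1 g.
Proof.
move=> lf lg fg.
have aux (h : Cq -> W) : linear h ->
    forall a, h a = qlin (fun u => h (qmon u.1 u.2)) a.
  move=> lh a; rewrite /qlin (@linear_malgE _ _ _ h) => [|k b c].
    by apply: eq_mlin => -[m n] /=; rewrite -qmonE.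
  by have := lh k b c; rewrite qtorusDE qtorusZE.
by move=> a; rewrite aux // [RHS]aux //; apply: eq_mlin => -[m n]; apply: fg.
Qed.

Lemma qtmulDl : left_distributive qtmul +%R.
Proof. by move=> a b c; have := qtmul_linearl c 1 a b; rewrite !scale1r. Qed.

Lemma qtmulDr : right_distributive qtmul +%R.
Proof. by move=> a b c; have := qtmul_linearr a 1 b c; rewrite !scale1r. Qed.

Lemma qtmul0l b : qtmul 0 b = 0.
Proof. by apply: (addrI (qtmul 0 b)); rewrite -qtmulDl !addr0. Qed.

Lemma qtmul0r a : qtmul a 0 = 0.
Proof. by apply: (addrI (qtmul a 0)); rewrite -qtmulDr !addr0. Qed.

Lemma qtmulZl k a b : qtmul (k *: a) b = k *: qtmul a b.
Proof. by have := qtmul_linearl b k a 0; rewrite !addr0 qtmul0l addr0. Qed.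

Lemma qtmulZr k a b : qtmul a (k *: b) = k *: qtmul a b.
Proof. by have := qtmul_linearr a k b 0; rewrite !addr0 qtmul0r addr0. Qed.

Lemma qtmul1l : left_id (qmon 0 0) qtmul.
Proof.
apply: eq_linear_qtorus => [|//|m n]; first exact: qtmul_linearr.
by rewrite qtmulMM mul0r expr0z scale1r !add0r.
Qed.

Lemma qtmul1r : right_id (qmon 0 0) qtmul.
Proof.
apply: eq_linear_qtorus => [|//|m n]; first exact: qtmul_linearl.
by rewrite qtmulMM mulr0 expr0z scale1r !addr0.
Qed.

Lemma qtmulA : associative qtmul.
Proof.
move=> a b c; move: a; apply: eq_linear_qtorus => [k a a'|k a a'|m n].
- by rewrite qtmulDl qtmulZl.
- by rewrite !qtmulDl !qtmulZl.
move: b; apply: eq_linear_qtorus => [k b b'|k b b'|m' n'].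
- by rewrite qtmulDl qtmulZl qtmulDr qtmulZr.
- by rewrite qtmulDr qtmulZr qtmulDl qtmulZl.
move: c; apply: eq_linear_qtorus => [k c c'|k c c'|p s].
- by rewrite !qtmulDr !qtmulZr.
- by rewrite !qtmulDr !qtmulZr.
rewrite !qtmulMM qtmulZr qtmulZl !qtmulMM !scalerA -!expfzDr // !addrA.
by congr (q ^ _ *: _); ring.
Qed.

Lemma qmon1_neq0 : qmon 0 0 != 0.
Proof.
apply/eqP => /(congr1 (qlin (fun=> 1 : F^o))) /eqP.
by rewrite linear0 qlin_qmon oner_eq0.
Qed.

HB.instance Definition _ := GRing.Zmodule_isNzRing.Build Cq
  qtmulA qtmul1l qtmul1r qtmulDl qtmulDr qmon1_neq0.
HB.instance Definition _ := GRing.Lmodule_isLalgebra.Build F Cq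
  (fun k a b => esym (qtmulZl k a b)).
HB.instance Definition _ := GRing.Lalgebra_isAlgebra.Build F Cq
  (fun k a b => esym (qtmulZr k a b)).

Lemma qmonM m n p s :
  qmon m n * qmon p s = q ^ (n * p) *: qmon (m + p) (n + s).
Proof. exact: qtmulMM. Qed.

Lemma qmon00 : qmon 0 0 = 1.
Proof. by []. Qed.

(* The anti-involution fixing x and inverting y: it sends the product x^m y^n *)
(* to the product y^(-n) x^m.                                                 *)
Definition qbar (a : Cq) : Cq := qlin (fun u => qmon 0 (- u.2) * qmon u.1 0) a.

Lemma qbar_is_linear : linear qbar.
Proof. exact: qlin_is_linear. Qed.

HB.instance Definition _ :=
  GRing.isLinear.Build F Cq Cq _ qbar qbar_is_linear.

Lemma qbar_mon m n : qbar (qmon m n) = q ^ (- (m * n)) *: qmon m (- n).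
Proof.
rewrite /qbar qlin_qmon qmonM add0r addr0.
by congr (q ^ _ *: _) => /=; ring.
Qed.

Lemma qbar_x : qbar (qmon 1 0) = qmon 1 0.
Proof. by rewrite qbar_mon mulr0 oppr0 expr0z scale1r. Qed.

Lemma qbar_y : qbar (qmon 0 1) = qmon 0 (-1).
Proof. by rewrite qbar_mon mul0r oppr0 expr0z scale1r. Qed.

Lemma qbarM a b : qbar (a * b) = qbar b * qbar a.
Proof.
move: a; apply: eq_linear_qtorus => [k a a'|k a a'|m n].
- by rewrite mulrDl -scalerAl linearP.
- by rewrite linearP mulrDr -scalerAr.
move: b; apply: eq_linear_qtorus => [k b b'|k b b'|p s].
- by rewrite mulrDr -scalerAr linearP.
- by rewrite linearP mulrDl -scalerAl.
rewrite qmonM linearZ /= !qbar_mon -scalerAl -scalerAr qmonM !scalerA.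
rewrite -!expfzDr //.
by congr (q ^ _ *: qmon _ _); ring.
Qed.

Lemma qbarK : involutive qbar.
Proof.
apply: eq_linear_qtorus => [k a b|//|m n]; first by rewrite !linearP.
rewrite qbar_mon linearZ /= qbar_mon scalerA opprK -expfzDr //.
by rewrite mulrN opprK addNr expr0z scale1r.
Qed.

(* F-vector space structure on matrices over the quantum torus (mathcomp only *)
(* provides the module structure over the entries).                           *)
Definition gl (r : nat) := 'M[Cq]_r.

Section Gl.
Variable r : nat.

HB.instance Definition _ := GRing.Zmodule.on (gl r).

Definition gl_scale (c : F) (A : gl r) : gl r := \matrix_(i, j) (c *: A i j).

Lemma gl_scaleA c d A : gl_scale c (gl_scale d A) = gl_scale (c * d) A.
Proof. by apply/matrixP => i j; rewrite !mxE scalerA. Qed.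
Lemma gl_scale1 : left_id 1 gl_scale.
Proof. by move=> A; apply/matrixP => i j; rewrite !mxE scale1r. Qed.
Lemma gl_scaleDr : right_distributive gl_scale +%R.
Proof. by move=> c A B; apply/matrixP => i j; rewrite !mxE scalerDr. Qed.
Lemma gl_scaleDl A : {morph gl_scale^~ A : c d / c + d}.
Proof. by move=> c d; apply/matrixP => i j; rewrite !mxE scalerDl. Qed.

HB.instance Definition _ := GRing.Zmodule_isLmodule.Build F (gl r)
  gl_scaleA gl_scale1 gl_scaleDr gl_scaleDl.

Lemma glZE (c : F) (A : gl r) i j : (c *: A) i j = c *: A i j.
Proof. exact: mxE. Qed.

(* e_ij(a) *)
Definition elem (i j : 'I_r) (a : Cq) : gl r :=
  \matrix_(k, l) (if (k == i) && (l == j) then a else 0).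

Lemma elemE i j a k l :
  elem i j a k l = if (k == i) && (l == j) then a else 0.
Proof. exact: mxE. Qed.

Definition comm (A B : gl r) : gl r := A *m B - B *m A.

Lemma elemM i j k l a b :
  elem i j a *m elem k l b = if j == k then elem i l (a * b) else 0.
Proof.
apply/matrixP => u v; rewrite mxE (bigD1 j) //= big1 ?addr0; last first.
  by move=> w /negPf wj; rewrite !elemE wj andbF mul0r.
rewrite !elemE eqxx andbT; case: (j == k); rewrite ?elemE ?mxE /=.
  by case: (u == i); case: (v == l); rewrite ?mul0r ?mulr0.
by rewrite mulr0.
Qed.

End Gl.

Definition Lam := {n : int | q ^ n == 1}.

(* The central element c(n), read as 0 when n is not in Lambda(q). *)
Definition cc (n : int) : {malg F[Lam]} :=
  if insub n is Some k then << (k : Lam) >> else 0.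

(* Components: the matrix, the coefficients of the c(n), that of c_y.         *)
Definition hatgl (r : nat) := (gl r * {malg F[Lam]} * F^o)%type.

HB.instance Definition _ r := GRing.Lmodule.on (hatgl r).

Section Hat.
Variable r : nat.

Definition cocycle_c (A B : gl r) : {malg F[Lam]} :=
  \sum_i \sum_j qlin (fun u => qlin (fun v =>
     (u.1%:~R * q ^ (u.2 * v.1) * (u.1 + v.1 == 0)%:R) *: cc (u.2 + v.2))
   (B j i)) (A i j).

Definition cocycle_y (A B : gl r) : F^o :=
  \sum_i \sum_j qlin (fun u => qlin (fun v =>
     (u.2%:~R * q ^ (u.2 * v.1) * (u.1 + v.1 == 0)%:R * (u.2 + v.2 == 0)%:R
      : F^o))
   (B j i)) (A i j).

Definition hat_bracket (X Y : hatgl r) : hatgl r :=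
  (comm X.1.1 Y.1.1, cocycle_c X.1.1 Y.1.1, cocycle_y X.1.1 Y.1.1).

Definition of_gl (A : gl r) : hatgl r := (A, 0, 0).
Definition cen (n : Lam) : hatgl r := (0, << n >>, 0).
Definition ceny : hatgl r := (0, 0, 1).

Lemma sum_qlin2_elem (W : lmodType F) (f : int * int -> int * int -> W)
    (i j k l : 'I_r) m n p s :
  \sum_i' \sum_j' qlin (fun u => qlin (f u) (elem k l (qmon p s) j' i'))
     (elem i j (qmon m n) i' j') =
  ((j == k)%:R * (i == l)%:R) *: f (m, n) (p, s).
Proof.
rewrite (bigD1 i) //= [X in _ + X]big1 ?addr0; last first.
  move=> i' /negPf ni; rewrite big1 // => j' _.
  by rewrite [elem i j _ _ _]elemE ni /= linear0.
rewrite (bigD1 j) //= big1 ?addr0; last first.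
  by move=> j' /negPf nj; rewrite [elem i j _ _ _]elemE nj andbF linear0.
rewrite [elem i j _ _ _]elemE !eqxx /= qlin_qmon elemE.
case: (j == k); case: (i == l) => /=;
  by rewrite ?linear0 ?qlin_qmon ?mulr0 ?mul0r ?mul1r ?scale0r ?scale1r.
Qed.

Lemma hat_bracketE (i j k l : 'I_r) (m n p s : int) :
  hat_bracket (of_gl (elem i j (qmon m n))) (of_gl (elem k l (qmon p s))) =
  ((j == k)%:R * q ^ (n * p)) *: of_gl (elem i l (qmon (m + p) (n + s)))
  - ((i == l)%:R * q ^ (m * s)) *: of_gl (elem k j (qmon (m + p) (n + s)))
  + (m%:~R * q ^ (n * p) * (j == k)%:R * (i == l)%:R * (m + p == 0)%:R)
     *: (0, cc (n + s), 0)
  + (n%:~R * q ^ (n * p) * (j == k)%:R * (i == l)%:R * (m + p == 0)%:R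
     * (n + s == 0)%:R) *: ceny.
Proof.
have elemZ (c : F) (u v : 'I_r) a : elem u v (c *: a) = c *: elem u v a.
  by apply/matrixP => x y; rewrite glZE !elemE; case: ifP; rewrite ?scaler0.
have combl (W : lmodType F) (x y b c d e : F) (w : W) : x * y = d ->
    x *: (y *: w) = b *: 0 - c *: 0 + d *: w + e *: 0.
  by move=> <-; rewrite !scaler0 oppr0 !add0r addr0 scalerA.
have combr (x y b c d e : F) : x * y = e ->
    x *: (y : F^o) = b *: 0 - c *: 0 + d *: 0 + e *: (1 : F^o).
  by move=> <-; rewrite !scaler0 oppr0 !add0r; apply: (esym (mulr1 _)).
have comb0 (W : lmodType F) (b c d e : F) (u w : W) :
    b *: u - c *: w = b *: u - c *: w + d *: 0 + e *: 0.
  by rewrite !scaler0 !addr0.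
congr (_, _, _).
- rewrite /= -comb0 /comm !elemM !qmonM !elemZ [p + m]addrC [s + n]addrC.
  rewrite [s * m]mulrC [l == i]eq_sym.
  by case: (j == k); case: (i == l);
    rewrite ?mul1r ?mul0r ?scale0r.
- rewrite /= /cocycle_c (sum_qlin2_elem (fun u v => _ *: cc _)).
  by apply: combl => /=; ring.
- rewrite /= /cocycle_y (sum_qlin2_elem (fun u v => (_ : F^o))).
  by apply: combr => /=; ring.
Qed.

End Hat.

Section Grho.
Variables (N : nat) (rho : F).

Definition Gmx : gl (N + N) := block_mx 0 1%:M (rho%:A)%:M 0.
Definition Ginv : gl (N + N) := block_mx 0 (rho^-1%:A)%:M 1%:M 0.

Lemma GmxK : rho != 0 -> Gmx *m Ginv = 1%:M /\ Ginv *m Gmx = 1%:M.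
Proof.
move=> r0; have rK : rho%:A * rho^-1%:A = 1 :> Cq.
  by rewrite -scalerAl mul1r scalerA divff // scale1r.
have rK' : rho^-1%:A * rho%:A = 1 :> Cq.
  by rewrite -scalerAl mul1r scalerA mulVf // scale1r.
rewrite /Gmx /Ginv !mulmx_block !mul0mx !mulmx0 !add0r !addr0 !mulmx1.
by rewrite -!scalar_mxM rK rK' -!scalar_mx_block.
Qed.

Definition star (A : gl (N + N)) : gl (N + N) :=
  Ginv *m (map_mx qbar A)^T *m Gmx.

Definition in_S (A : gl (N + N)) : Prop := star A = - A.

Definition in_G (A : gl (N + N)) : Prop :=
  exists s : seq (F * (gl (N + N) * gl (N + N))),
    (forall t, t \in s -> in_S t.2.1 /\ in_S t.2.2) /\
    A = \sum_(t <- s) t.1 *: comm t.2.1 t.2.2.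

Definition in_hatG (X : hatgl (N + N)) : Prop := in_G X.1.1.

Definition f_til (i j : 'I_N) (m n : int) : gl (N + N) :=
  elem (lshift N i) (lshift N j) (qmon m n)
  - elem (rshift N j) (rshift N i) (qbar (qmon m n)).

Definition g_til (i j : 'I_N) (m n : int) : gl (N + N) :=
  elem (lshift N i) (rshift N j) (qmon m n)
  - rho *: elem (lshift N j) (rshift N i) (qbar (qmon m n)).

Definition h_til (i j : 'I_N) (m n : int) : gl (N + N) :=
  rho *: elem (rshift N i) (lshift N j) (qmon m n)
  - elem (rshift N j) (lshift N i) (qbar (qmon m n)).

Let bt m n (A : 'M[Cq]_(m, n)) : 'M[Cq]_(n, m) := (map_mx qbar A)^T.
Let sc m n (c : F) (A : 'M[Cq]_(m, n)) : 'M[Cq]_(m, n) :=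
  map_mx (fun a => c *: a) A.

Lemma star_block (P Q R T : 'M[Cq]_N) :
  star (block_mx P Q R T) =
    block_mx (sc (rho^-1 * rho) (bt T)) (sc rho^-1 (bt Q)) (sc rho (bt R)) (bt P).
Proof.
have scl c (A : 'M[Cq]_N) : (c%:A)%:M *m A = sc c A.
  by rewrite mul_scalar_mx; apply/matrixP => i j; rewrite !mxE -scalerAl mul1r.
have scr c (A : 'M[Cq]_N) : A *m (c%:A)%:M = sc c A.
  apply/matrixP => i j; rewrite !mxE (bigD1 j) //= big1 ?addr0 => [|k kj].
    by rewrite mxE eqxx mulr1n -scalerAr mulr1.
  by rewrite mxE (negPf kj) mulr0n mulr0.
have scsc c d (A : 'M[Cq]_N) : sc c (sc d A) = sc (c * d) A.
  by apply/matrixP => i j; rewrite !mxE scalerA.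
rewrite /star map_block_mx tr_block_mx /Ginv /Gmx !mulmx_block.
rewrite !mul0mx !mulmx0 !add0r !addr0 !mulmx1 !mul1mx !scl !scr.
by rewrite scsc mulrC.
Qed.

Lemma starB A B : star (A - B) = star A - star B.
Proof.
rewrite /star -mulmxBl -mulmxBr; congr (_ *m _ *m _).
by apply/matrixP => i j; rewrite !mxE raddfB.
Qed.

Lemma starD A B : star (A + B) = star A + star B.
Proof.
rewrite /star -mulmxDl -mulmxDr; congr (_ *m _ *m _).
by apply/matrixP => i j; rewrite !mxE raddfD.
Qed.

Lemma starM A B : rho != 0 -> star (A *m B) = star B *m star A.
Proof.
move=> /GmxK [GK _]; rewrite /star !mulmxA.
rewrite -[X in _ = X *m _]mulmxA -[X in _ = X *m _]mulmxA (mulmxA Gmx) GK mul1mx.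
congr (_ *m _); rewrite -mulmxA; congr (_ *m _).
apply/matrixP => i j; rewrite !mxE raddf_sum; apply: eq_bigr => k _.
by rewrite !mxE; apply: qbarM.
Qed.

Lemma in_S_comm A B : rho != 0 -> in_S A -> in_S B -> in_S (comm A B).
Proof.
move=> r0 SA SB; rewrite /in_S /comm starB !starM // SA SB.
by rewrite !mulmxN !mulNmx !opprK opprB.
Qed.

Lemma star0 : star 0 = 0.
Proof. by rewrite -[X in star X](subrr 0) starB subrr. Qed.

Lemma starZ c A : star (c *: A) = c *: star A.
Proof.
rewrite /star; apply/matrixP => i j; rewrite glZE !mxE scaler_sumr.
apply: eq_bigr => k _; rewrite scalerAl; congr (_ * _).
rewrite !mxE scaler_sumr; apply: eq_bigr => l _; rewrite scalerAr; congr (_ * _).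
by rewrite !mxE linearZ.
Qed.

Lemma in_G_in_S A : rho != 0 -> in_G A -> in_S A.
Proof.
move=> r0 [s [Ss ->]]; elim: s Ss => [|t s IH] Ss; rewrite /in_S.
  by rewrite big_nil star0 oppr0.
rewrite big_cons starD starZ opprD.
have [St1 St2] := Ss t (mem_head t s).
rewrite (in_S_comm r0 St1 St2) scalerN; congr (_ + _); apply: IH => u us.
by apply: Ss; rewrite inE us orbT.
Qed.

Lemma in_hatG_linear c X Y : in_hatG X -> in_hatG Y -> in_hatG (c *: X + Y).
Proof.
move=> [s [Ss eX]] [t [St eY]].
exists ([seq (c * u.1, u.2) | u <- s] ++ t); split=> [u|].
  by rewrite mem_cat => /orP[/mapP[v /Ss vS ->]|/St].
rewrite big_cat big_map /=; congr (_ + _); last exact: eY.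
rewrite -[LHS]/(c *: X.1.1) eX scaler_sumr; apply: eq_bigr => u _.
by rewrite scalerA.
Qed.

Lemma in_hatG_bracket X Y :
  rho != 0 -> in_hatG X -> in_hatG Y -> in_hatG (hat_bracket X Y).
Proof.
move=> r0 GX GY; exists [:: (1, (X.1.1, Y.1.1))]; split=> [t|].
  by rewrite inE => /eqP ->; split; apply: in_G_in_S.
by rewrite big_seq1 scale1r.
Qed.

Let elem_block (i j : 'I_N) a :
  [/\ elem (lshift N i) (lshift N j) a = block_mx (elem i j a) 0 0 0,
      elem (lshift N i) (rshift N j) a = block_mx 0 (elem i j a) 0 0,
      elem (rshift N i) (lshift N j) a = block_mx 0 0 (elem i j a) 0 &
      elem (rshift N i) (rshift N j) a = block_mx 0 0 0 (elem i j a)].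
Proof.
by split; rewrite -[LHS]submxK; congr block_mx; apply/matrixP => k l;
   rewrite !mxE ?eq_lshift ?eq_rshift ?eq_lrshift ?eq_rlshift ?andbF.
Qed.

Let scE n (c : F) i j a : sc c (elem i j a : 'M_n) = elem i j (c *: a).
Proof. by apply/matrixP => k l; rewrite !mxE; case: ifP; rewrite ?scaler0. Qed.

Let btE n i j a : bt (elem i j a : 'M_n) = elem j i (qbar a).
Proof.
by apply/matrixP => k l; rewrite !mxE andbC; case: ifP; rewrite ?linear0.
Qed.

Let bt0 n : bt (0 : 'M_n) = 0.
Proof. by apply/matrixP => k l; rewrite !mxE linear0. Qed.

Let sc0 n c : sc c (0 : 'M_n) = 0.
Proof. by apply/matrixP => k l; rewrite !mxE scaler0. Qed.

Let star_elem (i j : 'I_N) a : rho * rho = 1 ->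
  [/\ star (elem (lshift N i) (lshift N j) a) =
        elem (rshift N j) (rshift N i) (qbar a),
      star (elem (lshift N i) (rshift N j) a) =
        rho *: elem (lshift N j) (rshift N i) (qbar a),
      star (elem (rshift N i) (lshift N j) a) =
        rho *: elem (rshift N j) (lshift N i) (qbar a) &
      star (elem (rshift N i) (rshift N j) a) =
        elem (lshift N j) (lshift N i) (qbar a)].
Proof.
move=> rr; have r0 : rho != 0.
  by apply/eqP => r0; move/eqP: rr; rewrite r0 mul0r eq_sym oner_eq0.
have rV : rho^-1 = rho by rewrite -[LHS]mulr1 -rr mulrA mulVf // mul1r.
have elemZ (u v : 'I_(N + N)) b : rho *: elem u v b = elem u v (rho *: b).
  by apply/matrixP => x y; rewrite glZE !elemE; case: ifP; rewrite ?scaler0.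
have [-> -> -> ->] := elem_block i j a.
rewrite !star_block !elemZ.
have [-> _ _ ->] := elem_block j i (qbar a).
have [_ -> -> _] := elem_block j i (rho *: qbar a).
by rewrite !bt0 !sc0 !btE !scE rV rr scale1r.
Qed.

Lemma f_til_in_S i j m n : rho * rho = 1 -> in_S (f_til i j m n).
Proof.
move=> rr; rewrite /in_S /f_til starB opprB.
have [-> _ _ _] := star_elem i j (qmon m n) rr.
by have [_ _ _ ->] := star_elem j i (qbar (qmon m n)) rr; rewrite qbarK.
Qed.

Lemma g_til_in_S i j m n : rho * rho = 1 -> in_S (g_til i j m n).
Proof.
move=> rr; rewrite /in_S /g_til starB opprB starZ.
have [_ -> _ _] := star_elem i j (qmon m n) rr.
have [_ -> _ _] := star_elem j i (qbar (qmon m n)) rr.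
by rewrite qbarK scalerA rr scale1r.
Qed.

Lemma h_til_in_S i j m n : rho * rho = 1 -> in_S (h_til i j m n).
Proof.
move=> rr; rewrite /in_S /h_til starB opprB starZ.
have [_ _ -> _] := star_elem i j (qmon m n) rr.
have [_ _ -> _] := star_elem j i (qbar (qmon m n)) rr.
by rewrite qbarK scalerA rr scale1r.
Qed.

End Grho.

End QuantumTorus.

Variant gen (N : nat) : Type :=
  | GenF of 'I_N & 'I_N & int & int
  | GenG of 'I_N & 'I_N & int & int
  | GenH of 'I_N & 'I_N & int & int.

Definition gen_mx (F : fieldType) (q : F) (q_neq0 : q != 0) (N : nat) (rho : F)
    (x : gen N) : gl q_neq0 (N + N) :=
  match x with
  | GenF i j m n => f_til q_neq0 i j m n
  | GenG i j m n => g_til q_neq0 rho i j m n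
  | GenH i j m n => h_til q_neq0 rho i j m n
  end.

Section Fock.
Variables (F : fieldType) (N : nat) (rho : F) (V : lmodType F).
Variables a a' : 'I_N -> int -> {linear V -> V}.

(* A module over the presented algebra alpha(N, rho) is a vector space with   *)
(* operators a_i(m), a_i^*(m) (here [a i m], [a' i m]) satisfying the         *)
(* defining relations; its submodules are the subspaces they all preserve.    *)
Definition alpha_module : Prop :=
  forall (i j : 'I_N) (m n : int) (v : V),
    [/\ a i m (a j n v) + rho *: a j n (a i m v) = 0,
        a' i m (a' j n v) + rho *: a' j n (a' i m v) = 0 &
        a i m (a' j n v) + rho *: a' j n (a i m v) =
          (rho * (i == j)%:R * (m + n == 0)%:R) *: v].

Definition alpha_submodule (W : V -> Prop) : Prop :=
  [/\ W 0,
      forall (c : F) (u v : V), W u -> W v -> W (c *: u + v) &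
      forall (i : 'I_N) (m : int) (v : V), W v -> W (a i m v) /\ W (a' i m v)].

Definition alpha_simple : Prop :=
  (exists v : V, v != 0) /\
  forall W : V -> Prop, alpha_submodule W ->
    (forall v, W v -> v = 0) \/ (forall v, W v).

Definition vacuum (v0 : V) : Prop :=
  v0 != 0 /\
  forall i : 'I_N,
    (forall n : int, 0 < n -> a i n v0 = 0 /\ a' i n v0 = 0) /\ a' i 0 v0 = 0.

Definition is_V : Prop :=
  [/\ alpha_module, alpha_simple & exists v0, vacuum v0].

Definition normal_order (u w : int -> {linear V -> V}) (m n : int) (x : V) : V :=
  if m < n then u m (w n x)
  else if m == n then 2^-1 *: (u m (w n x) - rho *: w n (u m x))
  else - (rho *: w n (u m x)).

Lemma alpha_locally_nilpotent : rho != 0 -> is_V -> forall x, exists M : int,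
  forall n : int, M < n -> forall i, a i n x = 0 /\ a' i n x = 0.
Proof.
move=> r0 [rel [_ simple] [v0 [v0n vac]]] x.
pose W (y : V) := exists M : int,
  forall n : int, M < n -> forall i, a i n y = 0 /\ a' i n y = 0.
suff subW : alpha_submodule W.
  have [W0|] := simple W subW; last exact.
  case/eqP: v0n; apply: W0; exists 0 => n n0 i.
  by have [/(_ n n0)] := vac i.
split.
- by exists 0 => n _ i; rewrite !linear0.
- move=> c u v [M WM] [M' WM']; exists (Num.max M M') => n; rewrite gt_max.
  move=> /andP[/WM Mn /WM' M'n] i; rewrite !linearP.
  by have [-> ->] := Mn i; have [-> ->] := M'n i; rewrite scaler0 addr0.
have zero (y z : V) : y = 0 -> y + rho *: z = 0 -> z = 0.
  by move=> -> /eqP; rewrite add0r scaler_eq0 (negPf r0) => /eqP.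
move=> i m v [M WM]; split; exists (Num.max M (- m)) => n; rewrite gt_max;
  move=> /andP[/WM Mn mn] j; have [aj aj'] := Mn j.
- have [r1 _ r3] := rel i j m n v.
  split; first by apply: zero r1; rewrite aj linear0.
  apply: (zero (a i m (a' j n v))); first by rewrite aj' linear0.
  rewrite r3; have /negPf -> : m + n != 0 by clear -mn; lia.
  by rewrite mulr0 scale0r.
- have [_ _ r3] := rel j i n m v; split; last first.
    by have [_ r2 _] := rel i j m n v; apply: zero r2; rewrite aj' linear0.
  move: r3; rewrite aj linear0 scaler0 addr0 => ->.
  have /negPf -> : n + m != 0 by clear -mn; lia.
  by rewrite mulr0 scale0r.
Qed.

Lemma normal_order_bounded (u w : int -> {linear V -> V}) :
  rho != 0 -> is_V ->
  (exists i, u = a i \/ u = a' i) -> (exists i, w = a i \/ w = a' i) ->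
  forall m x, exists M : int,
    forall s : int, M < `|s| -> normal_order u w (m - s) s x = 0.
Proof.
move=> r0 hV [i hu] [j hw] m x.
have [M hM] := alpha_locally_nilpotent r0 hV x.
have uM n : M < n -> u n x = 0.
  by move=> /hM/(_ i)[h1 h2]; case: hu => ->.
have wM n : M < n -> w n x = 0.
  by move=> /hM/(_ j)[h1 h2]; case: hw => ->.
exists (`|M| + `|m|) => s hs; rewrite /normal_order.
have hs1 : m - s < s -> M < s by clear -hs; lia.
have hs2 : m - s = s -> M < s by clear -hs; lia.
have hs3 : (m - s < s) = false -> m - s <> s -> M < m - s by clear -hs; lia.
case: ifP => [ms|ms]; first by rewrite wM ?linear0 //; apply: hs1.
case: eqP => [e|ne]; last by rewrite uM ?linear0 ?scaler0 ?oppr0 //; apply: hs3.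
have Ms := hs2 e; rewrite e wM // uM //.
by rewrite (linear0 (u s)) (linear0 (w s)) scaler0 subrr scaler0.
Qed.

Variable q : F.

(* [\sum_(s \in A)] is the sum of a finitely supported family; the support is *)
(* finite here by [normal_order_bounded].                                     *)
Definition quad (u w : int -> {linear V -> V}) (m n : int) (x : V) : V :=
  \sum_(s \in [set: int]) q ^ (- (n * s)) *: normal_order u w (m - s) s x.

Definition f_op (i j : 'I_N) := quad (a i) (a' j).
Definition g_op (i j : 'I_N) := quad (a i) (a j).
Definition h_op (i j : 'I_N) := quad (a' i) (a' j).

Definition F_op (i j : 'I_N) (m n : int) (x : V) : V :=
  if q ^ n == 1 then f_op i j m n x
  else f_op i j m n x
       - (2^-1 * rho * (i == j)%:R * (m == 0)%:R
          * ((q ^ n + 1) / (q ^ n - 1))) *: x.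
Definition G_op := g_op.
Definition H_op := h_op.

Definition gen_op (x : gen N) : V -> V :=
  match x with
  | GenF i j m n => F_op i j m n
  | GenG i j m n => G_op i j m n
  | GenH i j m n => H_op i j m n
  end.

End Fock.

(* [pi] makes V a module over the Lie subalgebra [D] of [(L, br)]; its values *)
(* outside [D] are irrelevant.                                                *)
Definition lie_action (F : fieldType) (L V : lmodType F) (br : L -> L -> L)
    (D : L -> Prop) (pi : L -> {linear V -> V}) : Prop :=
  (forall (c : F) (X Y : L), D X -> D Y ->
     forall v, pi (c *: X + Y) v = c *: pi X v + pi Y v) /\
  (forall X Y : L, D X -> D Y ->
     forall v, pi (br X Y) v = pi X (pi Y v) - pi Y (pi X v)).

(* Main.v *)
Require Import Defs.
From HB Require Import structures.
From mathcomp Require Import all_boot all_order all_algebra.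
From mathcomp Require Import ring zify.
From mathcomp Require Import boolp classical_sets functions fsbigop.
From mathcomp Require Import monalg.
From mathcomp Require Import complex reals.

Set Implicit Arguments.
Unset Strict Implicit.
Unset Printing Implicit Defensive.

Import Order.TTheory GRing.Theory Num.Theory.

Local Open Scope ring_scope.
Local Open Scope complex_scope.

(* Write b_k (k < 2N) for the a_i followed by the a_i^*; the relations read   *)
(* {b_k(m), b_l(n)}_rho = om(k, l) delta_(m+n,0). Let Q_kl(m, n) be the sum   *)
(* of the q^(-ns) :b_k(m-s) b_l(s):. Each summand differs from the plain      *)
(* product by a scalar, so [Q_kl(m, n), b_j(p)] is a combination of two b's,  *)
(* and [Q_kl(m, n), Q_ij(p, r)] follows by the Leibniz rule: four quadratic   *)
(* sums, plus the scalars created by normal ordering them again. These are    *)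
(* the finite geometric sums                                                  *)
(*   1/2 + z + ... + z^(m-1) + z^m / 2 = (z^m - 1) (z + 1) / (2 (z - 1)),     *)
(* equal to m at z = 1: the case z = 1 is the cocycle, and the other case is  *)
(* absorbed by the constants of F_ij. Sending x^m y^n e_kl to +-Q_(k,l')(m, n)*)
(* with l' the index dual to l gives a linear map T on all of gl_2N with      *)
(*   [T(A), T(B)] = T([A - A^*, B]) + rho c(A - A^*, B),                      *)
(* hence T/2 with c(n) acting by rho/2 represents the fixed points of         *)
(* A |-> - A^*.                                                               *)

(** * Finitely supported sums over the integers *)

(** The spanning elements of [S_rho] satisfy linear relations, so prescribing operators on them
    would call for a consistency check. Instead [gl_op] is defined on all of [gl_2N];
    [shifted_quad_sym] amounts to its taking equal values at [A] and [- star rho A], so on [S_rho]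
    half of it is the required action ([fock_rep_gen]). The heart is the commutator of two quadratic
    sums. [quad_quad_comm] derives it from the Leibniz rule as two Wick sums, and [isum_wick_term]
    evaluates such a sum: normal ordering it again produces the scalar of [isum_half_step], which
    the constants of [shifted_quad] absorb except for the cocycle. By [hat_op_bracket_elem] one Wick
    sum is the bracket of [A] with [B], the other that of [- star rho A] with [B]. This is
    [gl_op_comm]. *)

Definition fin_supp (V : zmodType) (f : int -> V) : Prop :=
  exists r : seq int, forall s, s \notin r -> f s = 0.

Section FiniteSupport.
Variable V : zmodType.
Implicit Types f g : int -> V.

Lemma isumE f (r : seq int) : uniq r -> (forall s, s \notin r -> f s = 0) ->
  \sum_(s \in [set: int]) f s = \sum_(s <- r) f s.
Proof.
move=> ur f0; rewrite (fsbigE r) //; last by move=> i _ /f0.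
by apply: eq_bigl => s; rewrite in_setT.
Qed.

Lemma fin_supp_bound f :
  (exists M : int, forall s : int, M < `|s| -> f s = 0) -> fin_supp f.
Proof.
move=> [M fM]; exists ([seq Posz i | i <- iota 0 `|M|.+1]
  ++ [seq - Posz i | i <- iota 0 `|M|.+1]) => s.
rewrite mem_cat negb_or => /andP[s1 s2]; apply: fM.
rewrite ltNge; apply/negP => sM.
have [s0|s0] := lerP 0 s.
  case/mapP: s1; exists `|s|%N; last by lia.
  by rewrite mem_iota; lia.
case/mapP: s2; exists `|s|%N; last by lia.
by rewrite mem_iota; lia.
Qed.

Lemma fin_suppD f g : fin_supp f -> fin_supp g -> fin_supp (fun s => f s + g s).
Proof.
move=> [r fr] [t gt]; exists (r ++ t) => s.
by rewrite mem_cat negb_or => /andP[/fr -> /gt ->]; rewrite addr0.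
Qed.

Lemma fin_suppN f : fin_supp f -> fin_supp (fun s => - f s).
Proof. by move=> [r fr]; exists r => s /fr ->; rewrite oppr0. Qed.

Lemma fin_supp_can f (h h' : int -> int) : cancel h h' ->
  fin_supp f -> fin_supp (f \o h).
Proof.
move=> hK [r fr]; exists (map h' r) => s; move=> sr; apply: fr.
by apply: contra sr => sr; rewrite -[s]hK map_f.
Qed.

(** A sum with infinite support is 0 by convention, so additivity rests on finite support. *)
Lemma isumD f g : fin_supp f -> fin_supp g ->
  \sum_(s \in [set: int]) (f s + g s) =
  \sum_(s \in [set: int]) f s + \sum_(s \in [set: int]) g s.
Proof.
move=> [r fr] [t gt]; pose d := undup (r ++ t).
have dE s : s \notin d -> f s = 0 /\ g s = 0.
  by rewrite mem_undup mem_cat negb_or => /andP[/fr -> /gt ->].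
rewrite !(@isumE _ d) ?undup_uniq ?big_split // => s /dE[]// -> ->.
exact: addr0.
Qed.

Lemma isum_shift f (c : int) :
  \sum_(s \in [set: int]) f s = \sum_(s \in [set: int]) f (s + c).
Proof.
by apply: (reindex_fsbigT (fun s => s + c)); exists (fun s => s - c) => s; ring.
Qed.

Lemma isum_reflect f (c : int) :
  \sum_(s \in [set: int]) f s = \sum_(s \in [set: int]) f (c - s).
Proof.
by apply: (reindex_fsbigT (fun s => c - s)); exists (fun s => c - s) => s; ring.
Qed.

Lemma isum1 f (s0 : int) : (forall s, s != s0 -> f s = 0) ->
  \sum_(s \in [set: int]) f s = f s0.
Proof.
move=> f0; rewrite (isumE (r := [:: s0])) ?big_seq1 // => s.
by rewrite inE => /f0.
Qed.

Lemma fin_supp1 f (s0 : int) : (forall s, s != s0 -> f s = 0) -> fin_supp f.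
Proof. by move=> f0; exists [:: s0] => s; rewrite inE => /f0. Qed.

End FiniteSupport.

Lemma raddf_isum (V W : zmodType) (L : {additive V -> W}) (f : int -> V) :
  fin_supp f ->
  L (\sum_(s \in [set: int]) f s) = \sum_(s \in [set: int]) L (f s).
Proof.
move=> [r fr]; have dE s : s \notin undup r -> f s = 0.
  by rewrite mem_undup => /fr.
rewrite !(@isumE _ _ (undup r)) ?undup_uniq ?raddf_sum // => s /dE ->.
exact: raddf0.
Qed.

Lemma isumB (V : zmodType) (f g : int -> V) : fin_supp f -> fin_supp g ->
  \sum_(s \in [set: int]) (f s - g s) =
  \sum_(s \in [set: int]) f s - \sum_(s \in [set: int]) g s.
Proof.
move=> ff fg; rewrite isumD //; last exact: fin_suppN.
by congr (_ + _); rewrite (raddf_isum (@GRing.opp V)).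
Qed.

Lemma isumZ (F : fieldType) (V : lmodType F) (c : F) (f : int -> V) :
  fin_supp f ->
  \sum_(s \in [set: int]) c *: f s = c *: \sum_(s \in [set: int]) f s.
Proof. by move=> ff; rewrite (raddf_isum (c \*: @idfun V)). Qed.

Lemma fin_suppZ (F : fieldType) (V : lmodType F) (c : int -> F) (f : int -> V) :
  fin_supp f -> fin_supp (fun s => c s *: f s).
Proof. by move=> [r fr]; exists r => s /fr ->; rewrite scaler0. Qed.

Lemma linear_isum (F : fieldType) (V W : lmodType F) (L : {linear V -> W})
    (f : int -> V) : fin_supp f ->
  L (\sum_(s \in [set: int]) f s) = \sum_(s \in [set: int]) L (f s).
Proof. exact: (raddf_isum L). Qed.

Lemma fin_supp_linear (F : fieldType) (V W : lmodType F)
    (L : {linear V -> W}) (f : int -> V) :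
  fin_supp f -> fin_supp (fun s => L (f s)).
Proof. by move=> [r fr]; exists r => s /fr ->; apply: raddf0. Qed.

Section ScaledSums.
Variables (F : fieldType) (V : lmodType F).
Implicit Types (c : int -> F) (x y z : V).

Lemma fin_supp_scalel c x : fin_supp c -> fin_supp (fun s => c s *: x).
Proof. by move=> [r fr]; exists r => s /fr ->; rewrite scale0r. Qed.

Lemma isum_scalel c x : fin_supp c ->
  \sum_(s \in [set: int]) c s *: x = (\sum_(s \in [set: int]) c s) *: x.
Proof.
move=> [r fr]; have dE s : s \notin undup r -> c s = 0.
  by rewrite mem_undup => /fr.
rewrite !(@isumE _ _ (undup r)) ?undup_uniq ?scaler_suml // => s /dE ->.
exact: scale0r.
Qed.

Lemma scale_regroup (A D c d e : F) x y z :
  (A *: y - c *: x) - (D *: z - d *: x) + e *: x =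
  A *: y - D *: z + (e - c + d) *: x.
Proof.
rewrite opprB [d *: x - _]addrC addrACA -[LHS]addrA; congr (_ + _).
by rewrite -scaleNr -!scalerDl; congr (_ *: _); ring.
Qed.

End ScaledSums.

(** * Contraction constants *)

Section HalfStep.
Variable F : fieldType.

(** Share of the contraction that normal ordering removes from [b_k(m) b_l(n)], at [s = n - m]: all
    of it when the factors get swapped, half of it at equal modes. *)
Definition half_step (s : int) : F :=
  if s < 0 then 1 else if s == 0 then 2^-1 else 0.

(** Used when the total mode is 0: the two modes of a product are then opposite, and their
    difference is even. *)
Lemma half_step_double s : half_step (s + s) = half_step s.
Proof.
rewrite /half_step; have -> : (s + s < 0) = (s < 0) by lia.
by have -> : (s + s == 0) = (s == 0) by lia.
Qed.

Hypothesis two_neq0 : 2 != 0 :> F.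

(** The step falls in two jumps of size 1/2, so its increment lives at two points; this gives the
    recursion in [m] for [isum_half_step]. *)
Lemma half_step_diff s :
  half_step s - half_step (s + 1) = 2^-1 * (s == 0)%:R + 2^-1 * (s == -1)%:R.
Proof.
have half2 : 1 - 2^-1 = 2^-1 :> F by field.
rewrite /half_step; case: (ltrgtP s 0) => s0.
- have [->|s1] := eqVneq s (-1); first by rewrite /= mulr0 add0r mulr1.
  have -> : s + 1 < 0 by lia.
  by rewrite subrr mulr0 addr0.
- have -> : (s + 1 < 0) = false by lia.
  have -> : (s + 1 == 0) = false by lia.
  have -> : (s == -1) = false by lia.
  by rewrite subrr !mulr0 addr0.
by rewrite s0 /= mulr1 subr0 mulr0 addr0.
Qed.

Lemma fin_supp_half_step (c : int -> F) m :
  fin_supp (fun s => c s * (half_step s - half_step (s + m))).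
Proof.
apply: fin_supp_bound; exists `|m| => s ms; rewrite /half_step.
have -> : (s + m < 0) = (s < 0) by lia.
have -> : (s + m == 0) = false by lia.
have -> : (s == 0) = false by lia.
by rewrite subrr mulr0.
Qed.

(* 0 at z = 1, since x / 0 = 0; hence [shifted_quad] below specialises to    *)
(* F_ij(m, n) both for n in Lambda(q) and for the other n.                   *)
Definition coth_term (z : F) : F := (z + 1) / (z - 1).

(** Both sides vanish at [m = 0], and both grow by [(z^m + z^(m+1)) / 2] from [m] to [m + 1], also
    when [z = 1]. *)
Lemma isum_half_step (z : F) m : z != 0 ->
  \sum_(s \in [set: int]) z ^ (- s) * (half_step s - half_step (s + m)) =
  m%:~R * (z == 1)%:R + 2^-1 * (z ^ m - 1) * coth_term z.
Proof.
move=> z0; pose L (m : int) := \sum_(s \in [set: int])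
  z ^ (- s) * (half_step s - half_step (s + m)).
pose R m : F := m%:~R * (z == 1)%:R + 2^-1 * (z ^ m - 1) * coth_term z.
rewrite -[LHS]/(L m) -[RHS]/(R m).
have L0 : L 0 = R 0.
  rewrite /R expr0z subrr mulr0 !mul0r addr0 /L fsbig1 // => s _.
  by rewrite addr0 subrr mulr0.
have LS k : L (k + 1) - L k = R (k + 1) - R k.
  rewrite /L -isumB; try exact: fin_supp_half_step.
  (* After this shift the jumps of [half_step] sit at the fixed indices 0 and -1. *)
  rewrite (isum_shift _ (- k)).
  rewrite (isumE (r := [:: 0; -1])) //; last first.
    move=> s; rewrite !inE negb_or => /andP[/negPf s0 /negPf s1].
    have := half_step_diff s; rewrite s0 s1 !mulr0 addr0 => /eqP.
    rewrite subr_eq0 => /eqP e.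
    have -> : s - k + (k + 1) = s + 1 by ring.
    have -> : s - k + k = s by ring.
    by rewrite e; ring.
  rewrite !big_cons big_nil /half_step.
  have -> : 0 - k + (k + 1) = 1 by ring.
  have -> : 0 - k + k = 0 by ring.
  have -> : -1 - k + (k + 1) = 0 by ring.
  have -> : -1 - k + k = -1 by ring.
  have -> : - (0 - k) = k by ring.
  have -> : - (-1 - k) = k + 1 by ring.
  rewrite /= /R /coth_term exprzDr ?unitfE // expr1z intrD mulr1z.
  (* These two step values occur in both sums and cancel. *)
  move: (if 0 - k < 0 then _ else _) (if -1 - k < 0 then _ else _) => t1 t2.
  have [->|z1] := eqVneq z 1.
    by rewrite exp1rz subrr invr0 !mulr0 !mulr1 !addr0; field.
  have zz : z - 1 != 0 by rewrite subr_eq0.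
  by rewrite mulr0n !mulr0 !add0r; field; rewrite ?zz ?two_neq0.
elim/int_ind: m => [//|k Lk|k Lk].
  have -> : k.+1%:Z = k%:Z + 1 by lia.
  by apply: (addIr (- L k)); rewrite LS Lk.
have -> : L (- k.+1%:Z) =
    L (- k.+1%:Z + 1) - (L (- k.+1%:Z + 1) - L (- k.+1%:Z)).
  by ring.
have -> : - k.+1%:Z + 1 = - k%:Z by lia.
have := LS (- k.+1%:Z); have -> : - k.+1%:Z + 1 = - k%:Z by lia.
by move=> ->; rewrite Lk; ring.
Qed.

End HalfStep.

(** * Normally ordered quadratic operators *)

Section Quadratic.
Variables (F : fieldType) (q rho : F).
Hypotheses (q_neq0 : q != 0) (two_neq0 : 2 != 0 :> F) (rho2 : rho * rho = 1).
Variables (V : lmodType F) (I : Type) (b : I -> int -> {linear V -> V}).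
Variable om : I -> I -> F.
Hypothesis omC : forall k l, om l k = rho * om k l.
Hypothesis car : forall k l m n x,
  b k m (b l n x) + rho *: b l n (b k m x) = (om k l * (m + n == 0)%:R) *: x.

Local Notation no := (fun k l => normal_order rho (b k) (b l)).
Hypothesis no_fin_supp : forall k l m x,
  fin_supp (fun s => no k l (m - s) s x).

Local Notation Q := (fun k l => quad rho q (b k) (b l)).

Lemma normal_orderE k l m n x : no k l m n x =
  b k m (b l n x) - (om k l * (m + n == 0)%:R * half_step F (n - m)) *: x.
Proof.
have swap : - (rho *: b l n (b k m x)) =
    b k m (b l n x) - (om k l * (m + n == 0)%:R) *: x.
  by rewrite -car opprD addrA subrr add0r.
rewrite /normal_order /half_step; have [mn|nm|mn] := ltrgtP m n.
- have -> : (n - m < 0) = false by lia.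
  have -> : (n - m == 0) = false by lia.
  by rewrite mulr0 scale0r subr0.
- have -> : n - m < 0 by lia.
  by rewrite mulr1 swap.
rewrite mn in swap *; rewrite subrr /= swap addrA scalerBr scalerA mulrC.
congr (_ - _).
by rewrite -mulr2n -scaler_nat scalerA mulVf // scale1r.
Qed.

Lemma normal_order_linear k l m n : linear (no k l m n).
Proof.
by move=> c x y; rewrite !normal_orderE !linearP /= scalerBr scalerN addrACA.
Qed.

Lemma quad_linear k l m n : linear (Q k l m n).
Proof.
have fs x : fin_supp (fun s => q ^ (- (n * s)) *: no k l (m - s) s x).
  exact: fin_suppZ.
move=> c x y; rewrite /quad -isumZ // -isumD //; last first.
  exact: (fin_suppZ (fun=> c)).
apply: eq_fsbigr => s _; rewrite normal_order_linear scalerDr !scalerA.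
by rewrite mulrC.
Qed.

(** No scalar correction appears: at equal modes this is due to the symmetric average. *)
Lemma normal_orderC k l m n x : no k l m n x = - (rho *: no l k n m x).
Proof.
rewrite /normal_order eq_sym; have [mn|nm|->] := ltrgtP m n.
- by rewrite scalerN opprK scalerA rho2 scale1r.
- by [].
rewrite scalerA [rho * _]mulrC -scalerA -[RHS]scalerN; congr (_ *: _).
by rewrite scalerBr scalerA rho2 scale1r opprB.
Qed.

(** Reflect [s] to [m - s] and apply [normal_orderC] to each summand. *)
Lemma quad_sym k l m n x :
  Q k l m n x = - ((rho * q ^ (- (m * n))) *: Q l k m (- n) x).
Proof.
rewrite -scaleNr /quad -isumZ; last exact: fin_suppZ.
rewrite (isum_reflect _ m); apply: eq_fsbigr => s _.
have -> : m - (m - s) = s by ring.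
rewrite normal_orderC scaleNr scalerN !scalerA; congr (- (_ *: _)).
by rewrite -mulrA -expfzDr // [LHS]mulrC; congr (rho * q ^ _); ring.
Qed.

Lemma normal_order_comm k l m n j p x :
  no k l m n (b j p x) - b j p (no k l m n x) =
  (om l j * (n + p == 0)%:R) *: b k m x
  - (rho * om k j * (m + p == 0)%:R) *: b l n x.
Proof.
have sw k' l' m' n' y : b k' m' (b l' n' y) =
    (om k' l' * (m' + n' == 0)%:R) *: y - rho *: b l' n' (b k' m' y).
  by rewrite -car addrK.
have bB j' p' y z : b j' p' (y - z) = b j' p' y - b j' p' z by exact: linearB.
have bZ j' p' c y : b j' p' (c *: y) = c *: b j' p' y by exact: linearZ.
rewrite !normal_orderE bB bZ /= opprB addrA subrK.
rewrite [b l n (b j p x)]sw bB !bZ /= [b k m (b j p _)]sw.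
rewrite scalerBr !scalerA rho2 scale1r opprB mulrA.
by rewrite [_ - (_ *: _)]addrC addrA addrK.
Qed.

(** The deltas of [normal_order_comm] leave one summand each, at [s = - p] and at [s = m + p]. *)
Lemma quad_comm k l m n j p x :
  Q k l m n (b j p x) - b j p (Q k l m n x) =
  (om l j * q ^ (n * p)) *: b k (m + p) x
  - (rho * om k j * q ^ (- (n * (m + p)))) *: b l (m + p) x.
Proof.
have fs y : fin_supp (fun s => q ^ (- (n * s)) *: no k l (m - s) s y).
  exact: fin_suppZ.
rewrite /quad linear_isum //.
rewrite -isumB //; last exact: fin_supp_linear.
pose f1 s := (om l j * q ^ (- (n * s)) * (s + p == 0)%:R) *: b k (m - s) x.
pose f2 s := (rho * om k j * q ^ (- (n * s)) * (m - s + p == 0)%:R) *: b l s x.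
have f10 s : s != - p -> f1 s = 0.
  move=> sp; rewrite /f1; have -> : (s + p == 0) = false by lia.
  by rewrite mulr0 scale0r.
have f20 s : s != m + p -> f2 s = 0.
  move=> sp; rewrite /f2; have -> : (m - s + p == 0) = false by lia.
  by rewrite mulr0 scale0r.
transitivity (\sum_(s \in [set: int]) (f1 s - f2 s)).
  apply: eq_fsbigr => s _; rewrite [b j p (_ *: _)]linearZ /= -scalerBr.
  rewrite normal_order_comm scalerBr !scalerA /f1 /f2.
  by congr (_ *: _ - _ *: _); ring.
rewrite isumB; try by [exact: (fin_supp1 f10) | exact: (fin_supp1 f20)].
rewrite (isum1 f10) (isum1 f20) /f1 /f2 opprK addNr eqxx mulr1 mulrN opprK.
have -> : m - (m + p) + p == 0 by lia.
by rewrite mulr1.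
Qed.

(** The scalar is chosen to absorb the [coth_term] part of [isum_half_step], so that commutators
    close up to the cocycle. *)
Definition shifted_quad k l (m n : int) (x : V) : V :=
  Q k l m n x
  - (2^-1 * (m == 0)%:R * om k l * coth_term (q ^ n)) *: x.

Lemma shifted_quad_linear k l m n : linear (shifted_quad k l m n).
Proof.
move=> c x y; rewrite /shifted_quad quad_linear scalerBr scalerDr opprD addrACA.
by rewrite !scalerA [c * _]mulrC.
Qed.

(** * Commutator of two quadratic operators *)

Section QuadQuad.
Variables (i j : I) (p r : int) (x : V).

(* Half of the terms of [Q_kl(m, n), q^(-rs) b_i(p-s) b_j(s)]; the other half *)
(* is obtained by replacing Q_kl(m, n) by - rho q^(-mn) Q_lk(m, -n), to which *)
(* it is equal.                                                              *)
Definition wick_term k l (m n s : int) : V := q ^ (- (r * s)) *: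
  ((om l i * q ^ (n * (p - s))) *: b k (m + (p - s)) (b j s x)
   - (rho * om k j * q ^ (- (n * (m + s)))) *: b i (p - s) (b l (m + s) x)).

(** Both products are normally ordered again, the second one being centred at [s + m]. Either
    contraction alone may be nonzero for infinitely many [s]; their difference has finite
    support. *)
Lemma wick_termE k l m n s : wick_term k l m n s =
  (om l i * q ^ (n * p)) *:
    (q ^ (- ((n + r) * s)) *: no k j (m + p - s) s x)
  - (rho * om k j * q ^ (r * m)) *:
    (q ^ (- ((n + r) * (s + m))) *: no i l (m + p - (s + m)) (s + m) x)
  + (om l i * om k j * q ^ (n * p) * (m + p == 0)%:R *
     ((q ^ (n + r)) ^ (- s) * (half_step F s - half_step F (s + m)))) *: x.
Proof.
have pw a c : q ^ a * q ^ c = q ^ (a + c) by rewrite -expfzDr.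
rewrite !normal_orderE.
have -> : m + p - (s + m) = p - s by ring.
have -> : m + p - s = m + (p - s) by ring.
rewrite [s + m]addrC /wick_term !scalerBr !scalerA.
have -> : (m + (p - s) + s == 0) = (m + p == 0) by lia.
have -> : (p - s + (m + s) == 0) = (m + p == 0) by lia.
set y := b k _ _; set z := b i _ _.
have -> : q ^ (- (r * s)) * (om l i * q ^ (n * (p - s))) =
    om l i * q ^ (n * p) * q ^ (- ((n + r) * s)).
  by rewrite mulrCA -mulrA !pw; congr (_ * q ^ _); ring.
have -> : q ^ (- (r * s)) * (rho * om k j * q ^ (- (n * (m + s)))) =
    rho * om k j * q ^ (r * m) * q ^ (- ((n + r) * (m + s))).
  by rewrite mulrCA -mulrA !pw; congr (_ * q ^ _); ring.
rewrite scale_regroup -[LHS]addr0; congr (_ + _).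
rewrite [X in X *: x](_ : _ = 0) ?scale0r //.
have [mp|_] := eqVneq (m + p) 0; last by rewrite !(mulr0, mul0r) subr0 addr0.
have -> : s - (m + (p - s)) = s + s by rewrite -[RHS]subr0 -mp; ring.
have -> : m + s - (p - s) = (m + s) + (m + s) by rewrite -[LHS]addr0 -mp; ring.
rewrite !half_step_double (omC i l) !mulr1n !mulr1 exprz_exp mulrN.
have -> : rho * om k j * q ^ (r * m) * q ^ (- ((n + r) * (m + s))) =
    rho * om k j * (q ^ (n * p) * q ^ (- ((n + r) * s))).
  rewrite -!mulrA !pw; congr (_ * (_ * q ^ _)).
  have -> : p = - m by lia.
  by ring.
by ring.
Qed.

(** Put [z = q^(n+r)]. When [m + p = 0], [z^m q^(np) = q^(rm)], so the two parts of
    [(z^m - 1) coth_term z / 2] are the shifts of the two [shifted_quad]; the term [m] at [z = 1]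
    remains as the cocycle. *)
Lemma isum_wick_term k l m n :
  fin_supp (wick_term k l m n) /\
  \sum_(s \in [set: int]) wick_term k l m n s =
    (om l i * q ^ (n * p)) *: shifted_quad k j (m + p) (n + r) x
    - (rho * om k j * q ^ (r * m)) *: shifted_quad i l (m + p) (n + r) x
    + (om l i * om k j * q ^ (n * p) * m%:~R * (m + p == 0)%:R
       * (q ^ (n + r) == 1)%:R) *: x.
Proof.
pose g k' l' s := q ^ (- ((n + r) * s)) *: no k' l' (m + p - s) s x.
have fg k' l' : fin_supp (g k' l') by exact: fin_suppZ.
pose h s := (q ^ (n + r)) ^ (- s) * (half_step F s - half_step F (s + m)).
have fh : fin_supp h by exact: fin_supp_half_step.
pose C := om l i * om k j * q ^ (n * p) * (m + p == 0)%:R.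
have -> : wick_term k l m n = fun s =>
    (om l i * q ^ (n * p)) *: g k j s
    - (rho * om k j * q ^ (r * m)) *: g i l (s + m) + (C * h s) *: x.
  by apply/funext => s; rewrite wick_termE.
have f1 : fin_supp (fun s => (om l i * q ^ (n * p)) *: g k j s).
  exact: (fin_suppZ (fun=> _)).
have fs2 : fin_supp (fun s => g i l (s + m)).
  exact: (fin_supp_can (addrK m) (fg i l)).
have f2 : fin_supp (fun s => - ((rho * om k j * q ^ (r * m)) *: g i l (s + m))).
  exact/fin_suppN/(fin_suppZ (fun=> _)).
have f3 : fin_supp (fun s => C * h s).
  exact: (fin_suppZ (V := F^o) (fun=> C)).
have f12 := fin_suppD f1 f2; have f3' := fin_supp_scalel x f3.
split; first exact: fin_suppD.
rewrite (isumD f12 f3') (isumD f1 f2) (isumZ _ (fg k j)) (isum_scalel x f3).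
rewrite -(mulr_fsumr C setT h).
rewrite -scaleNr; under [X in _ + X + _]eq_fsbigr do rewrite -scaleNr.
have -> := isumZ (- (rho * om k j * q ^ (r * m))) fs2.
have <- := isum_shift (g i l) m.
have -> := isum_half_step two_neq0 m (expfz_neq0 (n + r) q_neq0).
rewrite scaleNr -/(Q k j (m + p) (n + r) x) -/(Q i l (m + p) (n + r) x).
rewrite /shifted_quad !scalerBr !scalerA scale_regroup scaleNr.
congr (_ + _ *: _).
rewrite /C; have [mp|_] := eqVneq (m + p) 0; last first.
  by rewrite !(mulr0n, mulr0, mul0r) subr0 addr0.
rewrite !mulr1n !mulr1 mulrDr mulrA (omC i l).
have <- : (q ^ (n + r)) ^ m * q ^ (n * p) = q ^ (r * m).
  rewrite exprz_exp -expfzDr //; congr (q ^ _).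
  have -> : p = - m by lia.
  by ring.
by ring.
Qed.

(** The Leibniz rule gives four products for each [s]. A term from the first factor is paired with
    one from the second so that the contractions of a pair cancel for almost all [s]. *)
Lemma quad_quad_comm k l m n :
  Q k l m n (Q i j p r x) - Q i j p r (Q k l m n x) =
  \sum_(s \in [set: int]) wick_term k l m n s
  - (rho * q ^ (- (m * n))) *: \sum_(s \in [set: int]) wick_term l k m (- n) s.
Proof.
have [fkl _] := isum_wick_term k l m n.
have [flk _] := isum_wick_term l k m (- n).
pose L : {linear V -> V} := HB.pack (Q k l m n)
  (GRing.isLinear.Build _ _ _ _ _ (@quad_linear k l m n)).
pose g y s := q ^ (- (r * s)) *: no i j (p - s) s y.
have fg y : fin_supp (g y) by exact: fin_suppZ.
rewrite -[LHS]/(L (\sum_(s \in [set: int]) g x s)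
  - \sum_(s \in [set: int]) g (L x) s).
rewrite linear_isum // -isumB //; last exact: fin_supp_linear.
rewrite -isumZ // -isumB //; last exact: (fin_suppZ (fun=> _)).
apply: eq_fsbigr => s _; rewrite [L (_ *: _)]linearZ /= -scalerBr.
have LE c y z : L (y - c *: z) = L y - c *: L z by rewrite linearB linearZ.
have LN y : Q k l m n y = L y by [].
(* The scalar of [normal_orderE] commutes with [L], which leaves the Leibniz rule for the plain
   product. *)
have -> : L (no i j (p - s) s x) - no i j (p - s) s (L x) =
    (L (b i (p - s) (b j s x)) - b i (p - s) (L (b j s x)))
    + b i (p - s) (L (b j s x) - b j s (L x)).
  rewrite !normal_orderE LE [b i _ (_ - _)]linearB.
  by move: (om i j * _ * _) => c; rewrite addrA subrK opprB addrA subrK.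
rewrite -!LN !quad_comm linearB [b i _ (_ *: _)]linearZ.
rewrite [b i _ (_ *: b l _ _)]linearZ /=.
rewrite [X in _ *: (_ + X)]addrC addrACA [X in _ *: (_ + X)]addrC.
rewrite scalerDr /wick_term; congr (_ + _).
rewrite !scalerBr !scalerA opprB; congr (_ *: _ - _ *: _).
  have -> : q ^ (n * s) = q ^ (- (m * n)) * q ^ (- (- n * (m + s))).
    by rewrite -expfzDr //; congr (q ^ _); ring.
  by rewrite -[LHS]mul1r -rho2; ring.
have -> : q ^ (- (n * (m + (p - s)))) = q ^ (- (m * n)) * q ^ (- n * (p - s)).
  by rewrite -expfzDr //; congr (q ^ _); ring.
by ring.
Qed.

Lemma shifted_quad_comm k l m n :
  shifted_quad k l m n (shifted_quad i j p r x)
  - shifted_quad i j p r (shifted_quad k l m n x) =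
  \sum_(s \in [set: int]) wick_term k l m n s
  - (rho * q ^ (- (m * n))) *: \sum_(s \in [set: int]) wick_term l k m (- n) s.
Proof.
rewrite -quad_quad_comm.
have QB k' l' m' n' c y z : Q k' l' m' n' (y - c *: z) =
    Q k' l' m' n' y - c *: Q k' l' m' n' z.
  by rewrite -!scaleNr [y + _]addrC quad_linear addrC.
rewrite /shifted_quad !QB; set c := _ * coth_term _; set d := _ * coth_term _.
rewrite !scalerBr !scalerA [d * c]mulrC.
set y := _ *: Q i j p r x; set z := _ *: Q k l m n x; set w := _ *: x.
have regroup (u1 u2 : V) : u1 - z - (y - w) - (u2 - y - (z - w)) = u1 - u2.
  have -> : u1 - z - (y - w) = u1 - (y + (z - w)).
    by rewrite -[LHS]addrA -opprD addrCA.
  rewrite -[u2 - y - _]addrA -[- y - _]opprD.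
  by rewrite opprB addrA subrK.
exact: regroup.
Qed.

End QuadQuad.
End Quadratic.

(** * Bilinearity of the bracket *)

Lemma linear_fun0 (F : fieldType) (U W : lmodType F) (f : U -> W) :
  linear f -> f 0 = 0.
Proof.
move=> lf; have := lf (-1) 0 0.
by rewrite scaler0 addr0 scaleN1r addNr.
Qed.

Lemma linear_funZ (F : fieldType) (U W : lmodType F) (f : U -> W) c u :
  linear f -> f (c *: u) = c *: f u.
Proof. by move=> lf; rewrite -[c *: u]addr0 lf (linear_fun0 lf) addr0. Qed.

Lemma linear_funD (F : fieldType) (U W : lmodType F) (f : U -> W) u v :
  linear f -> f (u + v) = f u + f v.
Proof. by move=> lf; rewrite -[u]scale1r lf !scale1r. Qed.

Section Bilinear.
Variables (F : fieldType) (q : F) (q_neq0 : q != 0).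
Local Notation Cq := (qtorus q_neq0).
Local Notation qmon := (qmon q_neq0).

Lemma qlin_fun (W : lmodType F) c (f g : int * int -> W) (x : Cq) :
  qlin (fun k => c *: f k + g k) x = c *: qlin f x + qlin g x.
Proof. exact: mlin_fun. Qed.

Lemma eq_qlin (W : lmodType F) (f g : int * int -> W) (x : Cq) :
  f =1 g -> qlin f x = qlin g x.
Proof. by move=> fg; apply: eq_mlin. Qed.

Section Gl.
Variable r : nat.
Local Notation gl := (gl q_neq0 r).

Lemma elem_linear (i j : 'I_r) : linear (@elem F q q_neq0 r i j).
Proof.
move=> c x y; apply/matrixP => k l; rewrite [RHS]mxE glZE !elemE.
by case: ifP => _ //; rewrite scaler0 addr0.
Qed.

Lemma eq_linear_gl (W : lmodType F) (f g : gl -> W) : linear f -> linear g ->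
  (forall i j m n, f (elem i j (qmon m n)) = g (elem i j (qmon m n))) ->
  f =1 g.
Proof.
move=> lf lg fg A.
pose f' : {linear gl -> W} := HB.pack f (GRing.isLinear.Build _ _ _ _ f lf).
pose g' : {linear gl -> W} := HB.pack g (GRing.isLinear.Build _ _ _ _ g lg).
have sumE (h : 'I_r -> gl) k l : (\sum_i h i) k l = \sum_i h i k l.
  exact: summxE.
have -> : A = \sum_i \sum_j elem i j (A i j).
  apply/matrixP => k l; rewrite sumE.
  under eq_bigr do rewrite sumE.
  rewrite (bigD1 k) //= [X in _ + X]big1 ?addr0 => [|i /negPf ik]; last first.
    by rewrite big1 // => j _; rewrite elemE eq_sym ik.
  rewrite (bigD1 l) //= big1 ?addr0 ?elemE ?eqxx // => j /negPf jl.
  by rewrite elemE [l == j]eq_sym jl andbF.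
rewrite -[LHS]/(f' _) -[RHS]/(g' _) !linear_sum; apply: eq_bigr => i _.
rewrite !linear_sum; apply: eq_bigr => j _ /=; move: (A i j).
apply: eq_linear_qtorus => [c x y|c x y|m n]; last exact: fg.
  by rewrite elem_linear lf.
by rewrite elem_linear lg.
Qed.

Lemma sum_qlin_linear (W : lmodType F) (f : 'I_r -> 'I_r -> int * int -> W) :
  linear (fun A : gl => \sum_i \sum_j qlin (f i j) (A i j)).
Proof.
move=> c A B; rewrite scaler_sumr -big_split; apply: eq_bigr => i _.
rewrite scaler_sumr -big_split; apply: eq_bigr => j _ /=.
by rewrite mxE glZE linearP.
Qed.

Lemma sum_qlin2_linear (W : lmodType F)
    (f : 'I_r -> 'I_r -> int * int -> int * int -> W) (A : gl) :
  linear (fun B : gl =>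
    \sum_i \sum_j qlin (fun u => qlin (f i j u) (B j i)) (A i j)).
Proof.
move=> c B C; rewrite scaler_sumr -big_split; apply: eq_bigr => i _.
rewrite scaler_sumr -big_split; apply: eq_bigr => j _ /=.
by rewrite -qlin_fun; apply: eq_qlin => u; rewrite mxE glZE linearP.
Qed.

Lemma of_gl_linear : linear (@of_gl F q q_neq0 r).
Proof.
move=> c A B; have zeroE (W : lmodType F) : 0 = c *: 0 + 0 :> W.
  by rewrite scaler0 addr0.
congr (_, _, _); exact: zeroE.
Qed.

Lemma comm_linearl (B : gl) : linear (fun A : gl => comm A B).
Proof.
move=> c A A'; rewrite /comm mulmxDl mulmxDr scalerBr opprD addrACA.
congr (_ - _ + _); apply/matrixP => i j; rewrite glZE !mxE scaler_sumr;
  apply: eq_bigr => k _; rewrite glZE.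
  by rewrite -scalerAl.
by rewrite -scalerAr.
Qed.

Lemma comm_linearr (A : gl) : linear (fun B : gl => comm A B).
Proof.
have N X Y : comm X Y = - comm Y X :> gl by rewrite /comm opprB.
by move=> c B B'; rewrite N comm_linearl opprD -scalerN -!N.
Qed.

Lemma hat_bracket_linearl (B : gl) :
  linear (fun A : gl => hat_bracket (of_gl A) (of_gl B)).
Proof.
move=> c A A'; congr (_, _, _); first exact: comm_linearl.
  exact: sum_qlin_linear.
exact: (sum_qlin_linear (W := F^o)).
Qed.

Lemma hat_bracket_linearr (A : gl) :
  linear (fun B : gl => hat_bracket (of_gl A) (of_gl B)).
Proof.
move=> c B B'; congr (_, _, _); first exact: comm_linearr.
  exact: sum_qlin2_linear.
exact: (sum_qlin2_linear (W := F^o)).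
Qed.

End Gl.
End Bilinear.

(** Makes the shift compatible with [quad_sym], where [n] changes sign. *)
Lemma coth_termV (F : fieldType) (z : F) :
  z != 0 -> coth_term z^-1 = - coth_term z.
Proof.
move=> z0; rewrite /coth_term; have [->|z1] := eqVneq z 1.
  by rewrite invr1 subrr invr0 !mulr0 oppr0.
have z1' : z - 1 != 0 by rewrite subr_eq0.
have z1'' : 1 - z != 0 by rewrite subr_eq0 eq_sym.
by field; rewrite ?z0 ?z1' ?mulN1r ?z1''.
Qed.

(** * Indexing gl_2N by the generators of alpha(N, rho) *)

Section Twist.
Variables (F : fieldType) (q : F) (q_neq0 : q != 0) (N : nat) (rho : F).
Hypothesis rho2 : rho * rho = 1.

(* a_i and a_i^* are exchanged by [tau]; [eps] is the sign for which          *)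
(* x^m y^n e_kl |-> eps_k Q_(k, tau l)(m, n) is compatible with brackets.     *)
Definition tau (k : 'I_(N + N)) : 'I_(N + N) :=
  match fintype.split k with inl i => rshift N i | inr i => lshift N i end.

Definition eps (k : 'I_(N + N)) : F :=
  match fintype.split k with inl _ => 1 | inr _ => rho end.

Lemma split_lshift (i : 'I_N) : fintype.split (lshift N i) = inl i.
Proof. exact: (unsplitK (inl i)). Qed.

Lemma split_rshift (i : 'I_N) : fintype.split (rshift N i) = inr i.
Proof. exact: (unsplitK (inr i)). Qed.

Lemma tau_lshift i : tau (lshift N i) = rshift N i.
Proof. by rewrite /tau split_lshift. Qed.

Lemma tau_rshift i : tau (rshift N i) = lshift N i.
Proof. by rewrite /tau split_rshift. Qed.

Lemma eps_lshift i : eps (lshift N i) = 1.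
Proof. by rewrite /eps split_lshift. Qed.

Lemma eps_rshift i : eps (rshift N i) = rho.
Proof. by rewrite /eps split_rshift. Qed.

Definition twistE := (tau_lshift, tau_rshift, eps_lshift, eps_rshift).

Lemma tauK : involutive tau.
Proof. by move=> k; case: (split_ordP k) => i ->; rewrite !twistE. Qed.

Lemma eps_tau k : eps (tau k) = rho * eps k.
Proof. by case: (split_ordP k) => i ->; rewrite !twistE ?mulr1 ?rho2. Qed.

Lemma eps2 k : eps k * eps k = 1.
Proof. by case: (split_ordP k) => i ->; rewrite !twistE ?mulr1. Qed.

Definition car_form (k l : 'I_(N + N)) : F := rho * eps k * (l == tau k)%:R.

Lemma car_formC k l : car_form l k = rho * car_form k l.
Proof.
rewrite /car_form eq_sym (can2_eq tauK tauK).
by have [->|_] := eqVneq l (tau k); rewrite ?mulr0n ?mulr0 // eps_tau !mulrA.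
Qed.

(** [Gmx] is monomial: its only nonzero entry in row [k] is [eps k], in column [tau k]. Conjugation
    by it relabels entries and multiplies them by signs. *)
Lemma starE (A : gl q_neq0 (N + N)) k l :
  star rho A k l = (eps k * eps l) *: qbar (A (tau l) (tau k)).
Proof.
have r0 : rho != 0.
  by apply/eqP => r0; move/eqP: rho2; rewrite r0 mul0r eq_sym oner_eq0.
have rV : rho^-1 = rho by rewrite -[LHS]mulr1 -rho2 mulKf.
rewrite -[A in LHS]submxK star_block rV rho2.
case: (split_ordP k) => i ->; case: (split_ordP l) => j ->;
  rewrite ?block_mxEul ?block_mxEur ?block_mxEdl ?block_mxEdr !twistE !mxE;
  by rewrite ?mulr1 ?mul1r ?rho2 ?scale1r.
Qed.

Lemma star_elem (k l : 'I_(N + N)) a :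
  star rho (elem k l a : gl q_neq0 (N + N)) =
  (eps k * eps l) *: elem (tau l) (tau k) (qbar a).
Proof.
apply/matrixP => i j; rewrite starE glZE !elemE !(can2_eq tauK tauK) andbC.
case: ifP => [/andP[/eqP -> /eqP ->]|_]; last by rewrite linear0 !scaler0.
by rewrite !eps_tau mulrACA rho2 mul1r mulrC.
Qed.

End Twist.

(** * The representation *)

Section Representation.
Variables (F : fieldType) (q rho : F) (q_neq0 : q != 0) (N : nat).
Hypotheses (two_neq0 : 2 != 0 :> F) (rho2 : rho * rho = 1).
Variables (V : lmodType F) (a a' : 'I_N -> int -> {linear V -> V}).
Hypothesis hV : is_V rho a a'.

Local Notation gl := (gl q_neq0 (N + N)).
Local Notation hatgl := (hatgl q_neq0 (N + N)).
Local Notation tau := (@tau N).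
Local Notation eps := (@eps F N rho).
Local Notation om := (@car_form F N rho).
Local Notation qmon := (qmon q_neq0).

Definition fock_op (k : 'I_(N + N)) : int -> {linear V -> V} :=
  match fintype.split k with inl i => a i | inr i => a' i end.

Lemma fock_op_lshift i : fock_op (lshift N i) = a i.
Proof. by rewrite /fock_op split_lshift. Qed.

Lemma fock_op_rshift i : fock_op (rshift N i) = a' i.
Proof. by rewrite /fock_op split_rshift. Qed.

Lemma fock_op_car k l m n x :
  fock_op k m (fock_op l n x) + rho *: fock_op l n (fock_op k m x) =
  (om k l * (m + n == 0)%:R) *: x.
Proof.
have [rel _ _] := hV; rewrite /car_form.
case: (split_ordP k) => i ->; case: (split_ordP l) => j ->;
  rewrite ?fock_op_lshift ?fock_op_rshift !twistE.
- rewrite eq_lrshift mulr0 mul0r scale0r.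
  by have [] := rel i j m n x.
- rewrite mulr1 eq_rshift eq_sym.
  by have [] := rel i j m n x.
- rewrite rho2 mul1r eq_lshift.
  have [_ _ r3] := rel j i n m x.
  (* The mixed relation is given with [a] first; multiplying it by [rho] reverses the order, as
     [rho * rho = 1]. *)
  transitivity (rho *: (a j n (a' i m x) + rho *: a' i m (a j n x))).
    by rewrite scalerDr scalerA rho2 scale1r addrC.
  by rewrite r3 scalerA !mulrA rho2 mul1r addrC.
rewrite eq_rlshift mulr0 mul0r scale0r.
by have [] := rel i j m n x.
Qed.

Lemma fock_op_fin_supp k l m x : fin_supp (fun s =>
  normal_order rho (fock_op k) (fock_op l) (m - s) s x).
Proof.
apply/fin_supp_bound/(normal_order_bounded (a := a) (a' := a')) => //.
- by apply/eqP => r0; move/eqP: rho2; rewrite r0 mul0r eq_sym oner_eq0.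
- case: (split_ordP k) => i ->; exists i;
    rewrite ?fock_op_lshift ?fock_op_rshift; by [left | right].
case: (split_ordP l) => i ->; exists i;
  rewrite ?fock_op_lshift ?fock_op_rshift; by [left | right].
Qed.

Local Notation SQ := (shifted_quad q rho fock_op om).

(** The shift lives at [m = 0], where [q^(-mn) = 1], and [coth_term] is odd under inversion, so the
    shift obeys the symmetry of [quad_sym]. *)
Lemma shifted_quad_sym k l m n x : SQ k l m n x =
  - ((rho * q ^ (- (m * n))) *: SQ l k m (- n) x).
Proof.
rewrite /shifted_quad (quad_sym q_neq0 rho2 fock_op_fin_supp).
rewrite scalerBr opprB addrC scalerA -scaleNr; congr (_ *: _ + _).
rewrite car_formC // -[q ^ (- n)]invr_expz coth_termV ?expfz_neq0 //.
have [->|_] := eqVneq m 0; last by rewrite mulr0n mulr0 !mul0r mulr0 oppr0.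
by rewrite mul0r oppr0 expr0z; ring.
Qed.

Definition elem_op k l m n x : V := eps k *: SQ k (tau l) m n x.

Definition gl_op (A : gl) x : V :=
  \sum_k \sum_l qlin (fun u => elem_op k l u.1 u.2 x) (A k l).

Lemma gl_op_linearl x : linear (gl_op^~ x).
Proof. exact: sum_qlin_linear. Qed.

Lemma gl_op_linear A : linear (gl_op A).
Proof.
move=> c x y; rewrite /gl_op scaler_sumr -big_split; apply: eq_bigr => k _.
rewrite scaler_sumr -big_split; apply: eq_bigr => l _ /=.
rewrite -qlin_fun; apply: eq_qlin => u; rewrite /elem_op shifted_quad_linear //.
- by rewrite scalerDr !scalerA mulrC.
- exact: fock_op_car.
exact: fock_op_fin_supp.
Qed.

Lemma gl_op_elem k l m n x : gl_op (elem k l (qmon m n)) x = elem_op k l m n x.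
Proof.
rewrite /gl_op (bigD1 k) //= [X in _ + X]big1 ?addr0; last first.
  move=> i /negPf ik.
  by rewrite big1 // => j _; rewrite elemE ik linear0.
rewrite (bigD1 l) //= big1 ?addr0 ?elemE ?eqxx ?qlin_qmon // => j /negPf jl.
by rewrite elemE jl andbF linear0.
Qed.

(** All [c(n)] act by one scalar, so only the sum of their coefficients enters. The scalar [rho]
    becomes [rho / 2] in [fock_rep]. *)
Definition hat_op (X : hatgl) x : V :=
  gl_op X.1.1 x + (rho * (mlin (fun _ => 1 : F^o) X.1.2 : F^o)) *: x.

Lemma hat_op_linearl x : linear (hat_op^~ x).
Proof.
move=> c X Y; rewrite /hat_op gl_op_linearl linearP scalerDr addrACA.
by rewrite scalerA -scalerDl mulrDr; congr (_ + (_ + _) *: _); apply: mulrCA.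
Qed.

Lemma hat_op_linear X : linear (hat_op X).
Proof.
move=> c x y; rewrite /hat_op gl_op_linear !scalerDr addrACA !scalerA.
by rewrite [c * _]mulrC.
Qed.

(** The terms of [hat_bracketE] match those of [isum_wick_term] one by one: [c_y] acts by 0, and the
    signs agree because [eps] squares to 1. *)
Lemma hat_op_bracket_elem i j k l m n p r x :
  hat_op (hat_bracket (of_gl (elem k l (qmon m n)))
    (of_gl (elem i j (qmon p r)))) x =
  (eps k * eps i) *: \sum_(s \in [set: int])
    wick_term q rho fock_op om i (tau j) p r x k (tau l) m n s.
Proof.
have linD X Y : hat_op (X + Y) x = hat_op X x + hat_op Y x.
  exact: linear_funD (hat_op_linearl x).
have linZ c X : hat_op (c *: X) x = c *: hat_op X x.
  exact: linear_funZ (hat_op_linearl x).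
have linE k' l' m' n' : hat_op (of_gl (elem k' l' (qmon m' n'))) x =
    elem_op k' l' m' n' x.
  by rewrite /hat_op gl_op_elem /= linear0 mulr0 scale0r addr0.
have lincc t : hat_op (0, cc q t, 0) x = (rho * (q ^ t == 1)%:R) *: x.
  rewrite /hat_op /= /cc; have -> : gl_op 0 x = 0.
    exact: linear_fun0 (gl_op_linearl x).
  by rewrite add0r; case: insubP => [u -> _|/negPf ->]; rewrite ?mlinU ?linear0.
have linc : hat_op (ceny q_neq0 (N + N)) x = 0.
  rewrite /hat_op /= linear0 mulr0 scale0r addr0.
  exact: linear_fun0 (gl_op_linearl x).
rewrite hat_bracketE !linD -scaleNr !linZ !linE lincc linc.
rewrite scaler0 addr0.
have [_ ->] := isum_wick_term q_neq0 two_neq0 (@car_formC _ _ _ rho2)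
  fock_op_car fock_op_fin_supp i (tau j) p r x k (tau l) m n.
have -> : om (tau l) i = eps l * (l == i)%:R.
  by rewrite /car_form eps_tau // tauK mulrA rho2 mul1r eq_sym.
have -> : om k (tau j) = rho * eps k * (k == j)%:R.
  by rewrite /car_form (inj_eq (inv_inj (@tauK N))) eq_sym.
have e2 y : eps y * eps y = 1 by exact: eps2.
rewrite scaleNr scalerDr scalerBr /elem_op !scalerA.
congr (_ *: _ - _ *: _ + _ *: _).
- have [->|_] := eqVneq l i; last by rewrite mulr0n !(mulr0, mul0r).
  rewrite !mulr1n.
  transitivity (eps i * eps i * (q ^ (n * p) * eps k)); last by ring.
  by rewrite e2; ring.
- have [->|_] := eqVneq k j; last by rewrite mulr0n !(mulr0, mul0r).
  rewrite !mulr1n.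
  transitivity (rho * rho * (eps j * eps j) * (q ^ (r * m) * eps i));
    last by ring.
  by rewrite rho2 e2 [m * r]mulrC; ring.
have [->|_] := eqVneq l i; last by rewrite mulr0n !(mulr0, mul0r).
have [->|_] := eqVneq k j; last by rewrite mulr0n !(mulr0, mul0r).
rewrite !mulr1n; set z := (_ == 1)%:R; set y := (_ == 0)%:R.
transitivity ((eps i * eps i) * (eps j * eps j) *
  (rho * q ^ (n * p) * m%:~R * y * z)); last by ring.
by rewrite !e2; ring.
Qed.

(** By bilinearity matrix units with monomial entries suffice. There the second Wick sum of
    [shifted_quad_comm], with [k] and [l] exchanged and [n] negated, is the first one for
    [star rho A]. *)
Lemma gl_op_comm A B x : gl_op A (gl_op B x) - gl_op B (gl_op A x) =
  hat_op (hat_bracket (of_gl (A - star rho A)) (of_gl B)) x.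
Proof.
have swapB (c : F) (u v y z : V) :
    c *: u + v - (c *: y + z) = c *: (u - y) + (v - z).
  by rewrite scalerBr opprD addrACA.
pose f A B := gl_op A (gl_op B x) - gl_op B (gl_op A x).
pose g A B := hat_op (hat_bracket (of_gl A) (of_gl B)) x.
have lA := gl_op_linearl; have lx := gl_op_linear.
have fA B' : linear (f^~ B').
  by move=> c A1 A2; rewrite /f !lA lx swapB.
have fB A' : linear (f A').
  by move=> c A1 A2; rewrite /f !lA lx swapB.
have gA B' : linear (g^~ B').
  by move=> c A1 A2; rewrite /g hat_bracket_linearl hat_op_linearl.
have gB A' : linear (g A').
  by move=> c A1 A2; rewrite /g hat_bracket_linearr hat_op_linearl.
have gS B' : linear (fun A => g (A - star rho A) B').
  move=> c A1 A2; rewrite -gA; congr (g _ B').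
  rewrite starD starZ opprD addrACA; congr (_ + _).
  by rewrite -scalerBr.
rewrite -[LHS]/(f A B) -[RHS]/(g (A - star rho A) B).
apply: (eq_linear_gl (fA B) (gS B)) => k l m n.
apply: (eq_linear_gl (fB _) (gB _)) => i j p r.
rewrite star_elem // qbar_mon.
have eZ c k' l' y : elem k' l' (c *: y) = c *: elem k' l' y :> gl.
  by apply: linear_funZ; exact: elem_linear.
rewrite eZ scalerA addrC -scaleNr gA /f /g !hat_op_bracket_elem !gl_op_elem.
have sqZ c k' l' m' n' y : SQ k' l' m' n' (c *: y) = c *: SQ k' l' m' n' y.
  apply: linear_funZ; apply: shifted_quad_linear => //.
    exact: fock_op_car.
  exact: fock_op_fin_supp.
rewrite /elem_op !sqZ !scalerA [eps i * _]mulrC -scalerBr.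
rewrite (shifted_quad_comm q_neq0 two_neq0 rho2 (@car_formC _ _ _ rho2)
  fock_op_car fock_op_fin_supp).
rewrite mulNr scalerBr addrC tauK scaleNr scalerA; congr (_ - _ *: _).
rewrite eps_tau //.
transitivity (eps l * eps l * (eps k * eps i * rho * q ^ (- (m * n))));
  last by ring.
by rewrite eps2 //; ring.
Qed.

(* The two terms of each generator contribute equally to [hat_op], by         *)
(* [shifted_quad_sym]; hence the factor 1/2.                                  *)
Definition fock_rep (X : hatgl) x : V := 2^-1 *: hat_op X x.

Lemma fock_rep_linear X : linear (fock_rep X).
Proof.
move=> c x y; rewrite /fock_rep hat_op_linear scalerDr !scalerA.
by rewrite [2^-1 * c]mulrC.
Qed.

(** On [S_rho], [A - star rho A = 2 A], so the product of two halves times this 2 is again 1/2. *)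
Lemma fock_rep_bracket X Y x : in_S rho X.1.1 ->
  fock_rep (hat_bracket X Y) x =
  fock_rep X (fock_rep Y x) - fock_rep Y (fock_rep X x).
Proof.
move=> SX; have glZ A c y : gl_op A (c *: y) = c *: gl_op A y.
  exact: linear_funZ (gl_op_linear A).
have glD A y z : gl_op A (y + z) = gl_op A y + gl_op A z.
  exact: linear_funD (gl_op_linear A).
have half4 : 2^-1 = 2^-1 * 2^-1 * 2 :> F by field.
have -> : fock_rep (hat_bracket X Y) x = (2^-1 * 2^-1) *:
    hat_op (hat_bracket (of_gl (X.1.1 - star rho X.1.1)) (of_gl Y.1.1)) x.
  have dbl (A : gl) : A + A = 1 *: A + A by rewrite scale1r.
  rewrite SX opprK dbl hat_bracket_linearl hat_op_linearl scale1r.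
  by rewrite -mulr2n -scaler_nat scalerA -half4.
rewrite -gl_op_comm /fock_rep /hat_op.
(* The central parts of [X] and [Y] act by the scalars [c] and [d], which drop out of the
   commutator. *)
set c := rho * _; set d := rho * _.
have pull (y z : V) e : 2^-1 *: (2^-1 *: y + e *: (2^-1 *: z)) =
    (2^-1 * 2^-1) *: (y + e *: z).
  by rewrite !scalerDr !scalerA mulrAC.
rewrite !glZ !glD !glZ !pull -scalerBr; congr (_ *: _).
rewrite !scalerDr !scalerA [d * c]mulrC -!addrA [X in - (_ + X)]addrCA.
have cancel (u w y z e : V) :
    u + (y + (z + (e - (w + (y + (z + e)))))) = u - w.
  transitivity (u + (y + (z + e) - (w + (y + (z + e))))).
    by rewrite -!addrA.
  by congr (u + _); rewrite opprD addrCA subrr addr0.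
by rewrite cancel.
Qed.

(** The form [car_form] vanishes between two [a] and between two [a'], so G and H carry no shift;
    for F the shift is the constant of [F_op]. *)
Lemma fock_rep_gen x v : fock_rep (of_gl (gen_mx q_neq0 rho x)) v =
  gen_op rho a a' q x v.
Proof.
have op_elem k l m n : gl_op (elem k l (qmon m n)) v = elem_op k l m n v.
  exact: gl_op_elem.
have glB A c B : gl_op (A - c *: B) v = gl_op A v - c *: gl_op B v.
  by rewrite -!scaleNr [A + _]addrC gl_op_linearl addrC.
have glZ A c : gl_op (c *: A) v = c *: gl_op A v.
  exact: linear_funZ (gl_op_linearl v).
have eZ c k' l' y : elem k' l' (c *: y) = c *: elem k' l' y :> gl.
  by apply: linear_funZ; exact: elem_linear.
have half2 (y : V) : 2^-1 *: (y + y) = y.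
  by rewrite -mulr2n -scaler_nat scalerA mulVf // scale1r.
rewrite /fock_rep /hat_op linear0 mulr0 scale0r addr0 /=.
case: x => i j m n /=.
- rewrite /f_til qbar_mon eZ glB !op_elem /elem_op !twistE scale1r scalerA.
  rewrite [q ^ _ * rho]mulrC -shifted_quad_sym half2 /shifted_quad /car_form.
  rewrite !twistE fock_op_lshift fock_op_rshift /F_op /f_op.
  rewrite eq_rshift [j == i]eq_sym mulr1.
  rewrite /coth_term; have [->|_] := eqVneq (q ^ n) 1.
    by rewrite subrr invr0 !mulr0 scale0r subr0.
  by congr (_ - _ *: _); ring.
- rewrite /g_til qbar_mon eZ scalerA glB !op_elem /elem_op !twistE !scale1r.
  rewrite -shifted_quad_sym half2 /shifted_quad /car_form.
  rewrite !twistE !fock_op_lshift.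
  by rewrite eq_lrshift mulr0n !(mulr0, mul0r) scale0r subr0.
rewrite /h_til qbar_mon eZ glB glZ !op_elem /elem_op !twistE !scalerA.
rewrite rho2 scale1r [q ^ _ * rho]mulrC -shifted_quad_sym half2.
rewrite /shifted_quad /car_form !twistE !fock_op_rshift.
by rewrite eq_rlshift mulr0n !(mulr0, mul0r) scale0r subr0.
Qed.

Lemma fock_rep_cen (n : Lam q) v :
  fock_rep (cen q_neq0 (N + N) n) v = (rho / 2) *: v.
Proof.
rewrite /fock_rep /hat_op /= (linear_fun0 (gl_op_linearl v)) add0r.
by rewrite mlinU mulr1 scalerA mulrC.
Qed.

Lemma fock_rep_ceny v : fock_rep (ceny q_neq0 (N + N)) v = 0.
Proof.
rewrite /fock_rep /hat_op /= (linear_fun0 (gl_op_linearl v)) add0r.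
by rewrite linear0 mulr0 scale0r scaler0.
Qed.

End Representation.

Theorem theorem2p1 (R : realType) (q : R[i]) (q_neq0 : q != 0)
    (N : nat) (N_ge1 : (1 <= N)%N)
    (rho : R[i]) (rho_pm1 : rho = 1 \/ rho = -1)
    (V : lmodType R[i]) (a a' : 'I_N -> int -> {linear V -> V})
    (hV : is_V rho a a') :
  exists pi : hatgl q_neq0 (N + N) -> {linear V -> V},
    [/\ lie_action (@hat_bracket _ q q_neq0 (N + N))
          (@in_hatG _ q q_neq0 N rho) pi,
        forall s : seq (R[i] * gen N),
          in_G rho (\sum_(t <- s) t.1 *: gen_mx q_neq0 rho t.2) ->
          forall v : V,
            pi (of_gl (\sum_(t <- s) t.1 *: gen_mx q_neq0 rho t.2)) v =
            \sum_(t <- s) t.1 *: gen_op rho a a' q t.2 v,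
        forall (n : Lam q) (v : V), pi (cen q_neq0 (N + N) n) v = (rho / 2) *: v &
        forall v : V, pi (ceny q_neq0 (N + N)) v = 0].
Proof.
have two_neq0 : 2 != 0 :> R[i] by rewrite pnatr_eq0.
have rho2 : rho * rho = 1 by case: rho_pm1 => ->; rewrite ?mulrNN mulr1.
have rho_neq0 : rho != 0.
  by case: rho_pm1 => ->; rewrite ?oppr_eq0 oner_eq0.
pose T : hatgl q_neq0 (N + N) -> {linear V -> V} := fun X =>
  HB.pack (@fock_rep _ q rho q_neq0 N V a a' X)
    (GRing.isLinear.Build _ _ _ _ _ (fock_rep_linear two_neq0 rho2 hV X)).
have lT v : linear (fun X => T X v).
  move=> c X Y /=; rewrite /fock_rep hat_op_linearl scalerDr !scalerA.
  by rewrite [2^-1 * c]mulrC.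
exists T; split.
- split=> [c X Y _ _ v|X Y GX GY v]; first exact: lT.
  (* [S_rho] is closed under commutators and linear combinations, hence contains the algebra they
     generate here. *)
  by apply: fock_rep_bracket => //; apply: in_G_in_S GX.
- move=> s _ v; elim: s => [|t s IH].
    by rewrite !big_nil; exact: (linear_fun0 (lT v)).
  rewrite !big_cons -IH of_gl_linear.
  by have <- := fock_rep_gen q_neq0 two_neq0 rho2 hV t.2 v; exact: lT.
- by move=> n v; apply: fock_rep_cen.
by move=> v; apply: fock_rep_ceny.
Qed.
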